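(* Let $(G/H,F)$ be a homogeneous Finsler manifold, where $F$ is the invariant $(\alpha,\beta)$-metric $$F(x,y)=\alpha(x,y)\,\phi\!\left(\frac{\tilde a(\tilde X(x),y)}{\alpha(x,y)}\right),\qquad \alpha(x,y)=\sqrt{\tilde a_x(y,y)},$$ defined by an invariant Riemannian metric $\tilde a$ on $G/H$ and an invariant vector field $\tilde X$ on $G/H$, and let $X=\tilde X(H)$. Let $Y\in\mathfrak g\setminus\{0\}$ with $Y_{\mathfrak m}\neq 0$, put $$r_{\mathfrak m}:=\frac{\tilde a(X,Y_{\mathfrak m})}{\sqrt{\tilde a(Y_{\mathfrak m},Y_{\mathfrak m})}},$$ and suppose that $\phi''(r_{\mathfrak m})\le 0$ and that $\tilde a(X,[Y,Z]_{\mathfrak m})=0$ for every $Z\in\mathfrak m$. Then $Y$ is a geodesic vector of $(G/H,F)$ if and only if $Y$ is a geodesic vector of $(G/H,\tilde a)$.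
   Context: A Finsler metric on a smooth $n$-dimensional manifold $M$ is a non-negative function $F:TM\to\mathbb R$, smooth on $TM\setminus\{0\}$, with $F(x,\lambda y)=\lambda F(x,y)$ for all $\lambda>0$, and such that the Hessian matrix $\left[\frac12\frac{\partial^2F^2}{\partial y^i\partial y^j}\right]$ is positive definite at every $(x,y)\in TM\setminus\{0\}$. $(\alpha,\beta)$-metrics: $\phi=\phi(s)$ is a positive $C^\infty$ function on $(-b_0,b_0)$ satisfying $\phi(s)-s\phi'(s)+(b^2-s^2)\phi''(s)>0$ for all $|s|\le b<b_0$. Given a Riemannian metric $\tilde a$ and a vector field $\tilde X$ on $M$ with $\sqrt{\tilde a(\tilde X(x),\tilde X(x))}<b_0$ for every $x\in M$, put $\alpha(x,y)=\sqrt{\tilde a_x(y,y)}$ and $\beta(x,y)=\tilde a(\tilde X(x),y)$; then $F=\alpha\,\phi(\beta/\alpha)$ is a Finsler metric, called an $(\alpha,\beta)$-metric. These conditions on $\phi$ and $\tilde X$ are assumed. Homogeneous spaces: a Finsler space $(M,F)$ is homogeneous if its isometry group acts transitively on $M$; here $M=G/H$ with $G$ a Lie group acting by isometries, and ''invariant'' means $G$-invariant. Let $\mathfrak g,\mathfrak h$ be the Lie algebras of $G,H$. The space is reductive, and $\mathfrak g=\mathfrak m\oplus\mathfrak h$ is a reductive (i.e. $\mathrm{Ad}(H)$-invariant) decomposition; the subscript $\mathfrak m$ denotes the projection to $\mathfrak m$ along $\mathfrak h$. $\mathfrak m$ is identified with $T_o(G/H)$, $o=H$, via $Z\mapsto \frac{d}{dt}\big|_{t=0}\exp(tZ)(o)$;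 thus $X=\tilde X(o)$ is an element of $\mathfrak m$ and $\tilde a$ at $o$ is an inner product on $\mathfrak m$. A non-zero vector $Y\in\mathfrak g$ is called a geodesic vector of $(G/H,\tilde a)$ (respectively of $(G/H,F)$) if the curve $\gamma(t)=\exp(tY)(o)$ is a geodesic of $(G/H,\tilde a)$ (respectively of $(G/H,F)$). *)

(* Defs.v *)
From HB Require Import structures.
From mathcomp Require Import all_boot all_order all_algebra.
From mathcomp Require Import all_classical all_reals all_analysis.
Set Implicit Arguments.
Unset Strict Implicit.
Unset Printing Implicit Defensive.
Import Order.TTheory GRing.Theory Num.Theory.
Import numFieldNormedType.Exports.
Local Open Scope classical_set_scope.
Local Open Scope ring_scope.

(* Meant for an open set A of a finite-dimensional space: f is C^0 when it is
   continuous, and C^(k+1) when it is (Frechet) differentiable and all its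
   directional derivatives are C^k. *)
Fixpoint Ck_on (R : realType) (V W : normedModType R) (k : nat)
    (A : set V) (f : V -> W) : Prop :=
  match k with
  | 0%N => forall x, A x -> {for x, continuous f}
  | k'.+1 => (forall x, A x -> differentiable f x) /\
             (forall v, Ck_on k' A (fun x => 'D_v f x))
  end.

Definition smooth_on (R : realType) (V W : normedModType R)
  (A : set V) (f : V -> W) : Prop := forall k, Ck_on k A f.

(* The atlas is indexed by the points: chart p is a chart around p, with domain
   dom p, and chinv p is its inverse (its values outside of the image of the
   chart are irrelevant). *)
Record manifold (R : realType) (n : nat) := Manifold {
  mpt :> topologicalType;
  mpt_hausdorff : hausdorff_space mpt;
  mpt_second_countable : @second_countable mpt;
  dom : mpt -> set mpt;
  chart : mpt -> mpt -> 'rV[R]_n;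
  chinv : mpt -> 'rV[R]_n -> mpt;
  dom_open : forall p, open (dom p);
  dom_self : forall p, dom p p;
  chartK : forall p x, dom p x -> chinv p (chart p x) = x;
  img_open : forall p, open (chart p @` dom p);
  chart_continuous : forall p x, dom p x -> {for x, continuous (chart p)};
  chinv_continuous : forall p u, (chart p @` dom p) u ->
    {for u, continuous (chinv p)};
  chart_compatible : forall p q,
    smooth_on (chart p @` (dom p `&` dom q)) (chart q \o chinv p) }.

Definition img (R : realType) (n : nat) (M : manifold R n) (p : M) :
  set 'rV[R]_n := chart p @` dom p.

Definition smooth_map (R : realType) (m n : nat)
    (M : manifold R m) (N : manifold R n) (f : M -> N) : Prop :=
  continuous f /\ forall p q,
    smooth_on [set u | img p u /\ dom q (f (chinv p u))]
              (fun u => chart q (f (chinv p u))).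

Definition smooth_map2 (R : realType) (l m n : nat) (L : manifold R l)
    (M : manifold R m) (N : manifold R n) (f : L -> M -> N) : Prop :=
  continuous (fun z : L * M => f z.1 z.2) /\ forall p q r,
    smooth_on [set w : 'rV[R]_l * 'rV[R]_m |
                 [/\ img p w.1, img q w.2 &
                     dom r (f (chinv p w.1) (chinv q w.2))]]
              (fun w => chart r (f (chinv p w.1) (chinv q w.2))).

Definition smooth_curve (R : realType) (n : nat) (M : manifold R n)
    (c : R -> M) : Prop :=
  continuous c /\ forall p,
    smooth_on [set t | dom p (c t)] (fun t => chart p (c t)).

(* A tangent vector at x is represented by its components in the chart
   [chart x], so that every tangent space T_x M is 'rV[R]_n. *)
Definition tangent_map (R : realType) (m n : nat) (M : manifold R m)
    (N : manifold R n) (f : M -> N) (x : M) (v : 'rV[R]_m) : 'rV[R]_n :=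
  'D_v (fun u => chart (f x) (f (chinv x u))) (chart x x).

Definition velocity (R : realType) (n : nat) (M : manifold R n)
    (c : R -> M) (t : R) : 'rV[R]_n :=
  derive1 (fun s => chart (c t) (c s)) t.

(* components in the chart [chart p] of the tangent vector v at x *)
Definition to_chart (R : realType) (n : nat) (M : manifold R n) (p x : M)
    (v : 'rV[R]_n) : 'rV[R]_n :=
  'D_v (fun u => chart p (chinv x u)) (chart x x).

(* the tangent vector at chinv p u with components y in the chart [chart p] *)
Definition from_chart (R : realType) (n : nat) (M : manifold R n) (p : M)
    (u y : 'rV[R]_n) : 'rV[R]_n :=
  'D_y (fun w => chart (chinv p u) (chinv p w)) u.

Definition field_in_chart (R : realType) (n : nat) (M : manifold R n)
    (V : M -> 'rV[R]_n) (p : M) (u : 'rV[R]_n) : 'rV[R]_n :=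
  to_chart p (chinv p u) (V (chinv p u)).

Definition smooth_field (R : realType) (n : nat) (M : manifold R n)
    (V : M -> 'rV[R]_n) : Prop :=
  forall p, smooth_on (img p) (field_in_chart V p).

(* [V, W]^i = V^j d_j W^i - W^j d_j V^i *)
Definition field_bracket (R : realType) (n : nat) (M : manifold R n)
    (V W : M -> 'rV[R]_n) (x : M) : 'rV[R]_n :=
  'D_(V x) (field_in_chart W x) (chart x x)
  - 'D_(W x) (field_in_chart V x) (chart x x).

Record lie_group (R : realType) (N : nat) := LieGroup {
  lg_manifold :> manifold R N;
  lg_mul : lg_manifold -> lg_manifold -> lg_manifold;
  lg_one : lg_manifold;
  lg_inv : lg_manifold -> lg_manifold;
  lg_mulA : forall x y z, lg_mul x (lg_mul y z) = lg_mul (lg_mul x y) z;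
  lg_mul1 : forall x, lg_mul lg_one x = x;
  lg_mulV : forall x, lg_mul (lg_inv x) x = lg_one;
  lg_mul_smooth : smooth_map2 lg_mul;
  lg_inv_smooth : smooth_map lg_inv }.

Arguments lg_one {R N} _.

(* The Lie algebra of G is T_1 G = 'rV[R]_N, v being identified with the
   left-invariant vector field [left_field G v]. *)
Definition left_field (R : realType) (N : nat) (G : lie_group R N)
    (v : 'rV[R]_N) (g : G) : 'rV[R]_N :=
  tangent_map (fun k : G => lg_mul g k) (lg_one G) v.

Definition lie_bracket (R : realType) (N : nat) (G : lie_group R N)
    (v w : 'rV[R]_N) : 'rV[R]_N :=
  field_bracket (left_field (G := G) v) (left_field w) (lg_one G).

Definition Ad (R : realType) (N : nat) (G : lie_group R N) (g : G)
    (v : 'rV[R]_N) : 'rV[R]_N :=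
  tangent_map (fun k : G => lg_mul (lg_mul g k) (lg_inv g)) (lg_one G) v.

(* [is_exp c Y]: c is the curve t |-> exp(tY), i.e. the (unique) one-parameter
   subgroup of G with initial velocity Y. *)
Definition is_exp (R : realType) (N : nat) (G : lie_group R N)
    (c : R -> G) (Y : 'rV[R]_N) : Prop :=
  [/\ smooth_curve c,
      forall s t, c (s + t) = lg_mul (c s) (c t) &
      velocity c 0 = Y].

Definition closed_subgroup (R : realType) (N : nat) (G : lie_group R N)
    (H : set G) : Prop :=
  [/\ closed H, H (lg_one G),
      forall x y, H x -> H y -> H (lg_mul x y) &
      forall x, H x -> H (lg_inv x)].

Definition in_lie_algebra (R : realType) (N : nat) (G : lie_group R N)
    (H : set G) (Z : 'rV[R]_N) : Prop :=
  exists2 c : R -> G, is_exp c Z & forall t, H (c t).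

(* M is the coset manifold G/H: pi is the canonical projection g |-> gH and act
   is the action g (kH) = (gk)H. The smooth structure of G/H is the only one
   for which pi is a smooth submersion. *)
Record coset_manifold (R : realType) (N n : nat) (G : lie_group R N)
    (H : set G) (M : manifold R n) (pi : G -> M) (act : G -> M -> M) : Prop := {
  coset_surj : forall x, exists g, pi g = x;
  coset_fibre : forall g k, pi g = pi k <-> H (lg_mul (lg_inv g) k);
  coset_smooth : smooth_map pi;
  coset_submersion : forall g w, exists v, tangent_map pi g v = w;
  coset_act : forall g k, act g (pi k) = pi (lg_mul g k);
  coset_act_smooth : smooth_map2 act }.

Definition reductive_decomposition (R : realType) (N : nat)
    (G : lie_group R N) (H : set G) (m h : {vspace 'rV[R]_N}) : Prop :=
  [/\ forall Z, (Z \in h) <-> in_lie_algebra H Z,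
      (m + h = fullv)%VS, (m :&: h = 0)%VS &
      forall g Z, H g -> Z \in m -> Ad g Z \in m].

(* The tangent vector d/dt exp(tZ)(o) at t = 0, where o = H, written as the
   image of Z under the differential at 1 of g |-> g(o) = gH. *)
Definition tangent_at_o (R : realType) (N n : nat) (G : lie_group R N)
    (M : manifold R n) (pi : G -> M) (Z : 'rV[R]_N) : 'rV[R]_n :=
  tangent_map pi (lg_one G) Z.

Record riemannian_metric (R : realType) (n : nat) (M : manifold R n)
    (a : M -> 'rV[R]_n -> 'rV[R]_n -> R) : Prop := {
  rm_linear : forall x k u v w, a x (k *: u + v) w = k * a x u w + a x v w;
  rm_sym : forall x u v, a x u v = a x v u;
  rm_pos : forall x u, u != 0 -> 0 < a x u u;
  rm_smooth : forall p v w, smooth_on (img p)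
    (fun u => a (chinv p u) (from_chart p u v) (from_chart p u w)) }.

Definition rnorm (R : realType) (n : nat) (M : manifold R n)
    (a : M -> 'rV[R]_n -> 'rV[R]_n -> R) (x : M) (y : 'rV[R]_n) : R :=
  Num.sqrt (a x y y).

Definition fun_in_chart (R : realType) (n : nat) (M : manifold R n)
    (F : M -> 'rV[R]_n -> R) (p : M) (u y : 'rV[R]_n) : R :=
  F (chinv p u) (from_chart p u y).

Definition hessian (R : realType) (n : nat) (f : 'rV[R]_n -> R)
    (y : 'rV[R]_n) : 'M[R]_n :=
  \matrix_(i, j) 'D_(delta_mx 0 i) (fun z => 'D_(delta_mx 0 j) f z) y.

Definition positive_definite (R : realType) (n : nat) (A : 'M[R]_n) : Prop :=
  A^T = A /\ forall v : 'rV[R]_n, v != 0 -> 0 < (v *m A *m v^T) 0 0.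

Record finsler_metric (R : realType) (n : nat) (M : manifold R n)
    (F : M -> 'rV[R]_n -> R) : Prop := {
  fm_nonneg : forall x y, 0 <= F x y;
  fm_smooth : forall p,
    smooth_on [set w : 'rV[R]_n * 'rV[R]_n | img p w.1 /\ w.2 != 0]
              (fun w => fun_in_chart F p w.1 w.2);
  fm_homogeneous : forall x (k : R) y, 0 < k -> F x (k *: y) = k * F x y;
  fm_hessian : forall x y, y != 0 ->
    positive_definite (hessian (fun z => 2^-1 * F x z ^+ 2) y) }.

Definition invariant_fun (R : realType) (N n : nat) (G : lie_group R N)
    (M : manifold R n) (act : G -> M -> M) (F : M -> 'rV[R]_n -> R) : Prop :=
  forall g x y, F (act g x) (tangent_map (act g) x y) = F x y.

Definition invariant_form (R : realType) (N n : nat) (G : lie_group R N)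
    (M : manifold R n) (act : G -> M -> M)
    (a : M -> 'rV[R]_n -> 'rV[R]_n -> R) : Prop :=
  forall g x y z,
    a (act g x) (tangent_map (act g) x y) (tangent_map (act g) x z) = a x y z.

Definition invariant_field (R : realType) (N n : nat) (G : lie_group R N)
    (M : manifold R n) (act : G -> M -> M) (V : M -> 'rV[R]_n) : Prop :=
  forall g x, tangent_map (act g) x (V x) = V (act g x).

(* At y = 0 both alpha and the quotient beta / alpha = 0 / 0 are 0, so F = 0. *)
Definition ab_metric (R : realType) (n : nat) (M : manifold R n)
    (phi : R -> R) (a : M -> 'rV[R]_n -> 'rV[R]_n -> R) (X : M -> 'rV[R]_n)
    (x : M) (y : 'rV[R]_n) : R :=
  rnorm a x y * phi (a x (X x) y / rnorm a x y).

Record ab_function (R : realType) (phi : R -> R) (b0 : R) : Prop := {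
  ab_pos : forall s, `|s| < b0 -> 0 < phi s;
  ab_smooth : smooth_on [set s : R | `|s| < b0] phi;
  ab_convex : forall s b, `|s| <= b -> b < b0 ->
    0 < phi s - s * derive1 phi s + (b ^+ 2 - s ^+ 2) * derive1n 2 phi s }.

(* A (constant speed) geodesic is a smooth curve satisfying, in every chart, the
   Euler-Lagrange equations d/dt (dL/dy^i) = dL/dx^i of L = F^2/2. *)
Definition is_geodesic (R : realType) (n : nat) (M : manifold R n)
    (F : M -> 'rV[R]_n -> R) (c : R -> M) : Prop :=
  smooth_curve c /\
  forall (p : M) (t : R), dom p (c t) ->
    let L (x y : 'rV[R]_n) := 2^-1 * fun_in_chart F p x y ^+ 2 in
    let u (s : R) := chart p (c s) in
    forall v : 'rV[R]_n,
      is_derive t 1 (fun s => 'D_v (L (u s)) (derive1 u s))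
                    ('D_v (fun x => L x (derive1 u t)) (u t)).

(* The existential only names the curve t |-> exp(tY), see [is_exp]. *)
Definition geodesic_vector (R : realType) (N n : nat) (G : lie_group R N)
    (M : manifold R n) (pi : G -> M) (act : G -> M -> M)
    (F : M -> 'rV[R]_n -> R) (Y : 'rV[R]_N) : Prop :=
  Y != 0 /\
  exists2 c : R -> G, is_exp c Y &
    is_geodesic F (fun t => act (c t) (pi (lg_one G))).

(* Main.v *)
Require Import Defs.
From HB Require Import structures.
From mathcomp Require Import all_boot all_order all_algebra.
From mathcomp Require Import all_classical all_reals all_analysis.
From mathcomp Require Import ring lra.
Set Implicit Arguments.
Unset Strict Implicit.
Unset Printing Implicit Defensive.
Import Order.TTheory GRing.Theory Num.Theory.
Import numFieldNormedType.Exports.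
Local Open Scope classical_set_scope.
Local Open Scope ring_scope.

(** The curve gamma(t) = exp(tY) o is an orbit of a one-parameter group of
isometries, with generator xi, a vector field on G/H that is tangent to gamma.

For an invariant metric F put L = F^2 / 2. Invariance of L under the flow of xi
gives a conservation law: the momentum L_y at time s is the momentum at time t
transported by the flow. Differentiating it shows that the Euler-Lagrange
expression of gamma in a direction v is minus the derivative in that direction of
the energy x |-> L(x, xi(x)) (lemma [euler_lagrange_orbit], and
[orbit_euler_lagrange] on the manifold). So gamma is a geodesic of F if and only
if its points are critical points of this energy.

For F = alpha phi(beta / alpha) the energy is q^2 phi(s)^2 / 2, where
q = alpha(xi), b = a(X, xi) and s = b / q, and its differential is
phi(s) (phi(s) - s phi'(s)) q dq + q phi(s) phi'(s) db (lemma
[derive_ab_energy]), while the energy of alpha has differential q dq.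

The term with db vanishes on gamma. Indeed X and a are invariant, so a(X, .)
pulls back to a left-invariant 1-form on G. Its value on the left-invariant field
of Y is constant, its value on the right-invariant field of Y is b, and the
difference of the two has at the identity the derivative a(X, [Y, Z]_m) in
direction Z (lemma [derive_beta_orbit]); this is 0 for Z in m by hypothesis, and
m maps onto the tangent space at o.

The coefficient of q dq is nonzero: the Cauchy-Schwarz inequality gives
|s| <= |X| < b0, hence phi(s) > 0, and the convexity condition on phi, taken with
b = |s|, says that phi(s) - s phi'(s) > 0. Hence both energies have the same
critical points on gamma (lemma [euler_lagrange_ab_iff]).

All of this requires q > 0, that is, xi nonzero on gamma. If xi vanished at o,
exp(tY) would fix o for all t, so Y would lie in h and Y_m would be 0 (lemmas
[exp_in_isotropy] and [tangent_at_o_neq0]). *)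

(** * Directional derivatives in normed modules *)

Section Calculus.
Variables (R : realType) (U V W : normedModType R).

Lemma near_eq_differentiable (f g : V -> W) (a : V) :
  (\near a, f a = g a) -> differentiable f a -> differentiable g a.
Proof.
move=> fg df; have fga := nbhs_singleton fg.
have E : g \o shift a = cst (g a) + 'd f a +o_ 0 id.
  apply/eqaddoP => e e0.
  have /eqaddoP/(_ e e0) := diff_locally df.
  have : \forall x \near 0, f (x + a) = g (x + a).
    by move: fg; rewrite (near_shift 0) /= subr0; apply: filterS => x.
  apply: filterS2 => x /= fgx.
  by rewrite !fctE /= fgx fga.
have c := diff_continuous df.
by apply/diff_locallyP; rewrite (diff_unique c E).
Qed.

Lemma derive_comp (h : U -> V) (f : V -> W) (a v : U) :
  differentiable h a -> differentiable f (h a) ->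
  'D_v (f \o h) a = 'D_('D_v h a) f (h a).
Proof.
move=> dh df; rewrite !deriveE //; last exact: differentiable_comp.
by rewrite diff_comp.
Qed.

Lemma derive_dir_linear (f : V -> W) (a v w : V) (k : R) : differentiable f a ->
  'D_(k *: v + w) f a = k *: 'D_v f a + 'D_w f a.
Proof. by move=> df; rewrite !deriveE // linearP. Qed.

Lemma derive_pair (h : U -> V) (k : U -> W) (a v : U) :
  differentiable h a -> differentiable k a ->
  'D_v (fun x => (h x, k x)) a = ('D_v h a, 'D_v k a).
Proof.
move=> dh dk; rewrite deriveE; last exact: differentiable_pair.
by rewrite diff_pair // !deriveE.
Qed.

Lemma derive_dirD (f : V -> W) (a v w : V) : differentiable f a ->
  'D_(v + w) f a = 'D_v f a + 'D_w f a.
Proof. by move=> df; rewrite !deriveE // linearD. Qed.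

Lemma derive_dirN (f : V -> W) (a v : V) : differentiable f a ->
  'D_(- v) f a = - 'D_v f a.
Proof. by move=> df; rewrite !deriveE // linearN. Qed.

(** The factor [B] need not be differentiable: being linear, it maps the
difference quotients of [g \o B] to those of [g]. *)
Lemma derive_comp_linear (B : U -> V) (g : V -> W) (a v : U) :
  linear B -> 'D_v (g \o B) a = 'D_(B v) g (B a).
Proof.
move=> linB; rewrite /derive.
set F := (fun _ : R => _); set G := (fun _ : R => _).
by suff -> : F = G by []; apply/funext => h; rewrite /F /G /= linB.
Qed.

Lemma derive_functional (f : V -> R) (a v : V) :
  (forall k u w, f (k *: u + w) = k * f u + f w) -> 'D_v f a = f v.
Proof.
move=> flin; rewrite /derive; apply: lim_near_cst => //.
near=> h; have h0 : h != 0 by near: h; exact: nbhs_dnbhs_neq.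
by rewrite /= flin addrK -[LHS]/(h^-1 * (h * f v)) mulKf.
Unshelve. all: by end_near. Qed.

End Calculus.

Section Pairs.
Variables (R : realType) (V W : normedModType R).

Lemma differentiable_fst (z : V * W) : differentiable (fun y : V * W => y.1) z.
Proof.
have lin : linear (fun y : V * W => y.1) by [].
pose fM := GRing.isLinear.Build _ _ _ _ _ lin.
pose fL : {linear (V * W)%type -> V} := HB.pack (fun y : V * W => y.1) fM.
apply: (@linear_differentiable _ _ _ fL) => x; exact: cvg_fst.
Qed.

Lemma differentiable_snd (z : V * W) : differentiable (fun y : V * W => y.2) z.
Proof.
have lin : linear (fun y : V * W => y.2) by [].
pose fM := GRing.isLinear.Build _ _ _ _ _ lin.
pose fL : {linear (V * W)%type -> W} := HB.pack (fun y : V * W => y.2) fM.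
apply: (@linear_differentiable _ _ _ fL) => x; exact: cvg_snd.
Qed.

End Pairs.

Section Partial.
Variables (R : realType) (U V W : normedModType R).
Variable (f : U * V -> W).

Lemma derive_snd a x y : differentiable f (a, x) ->
  'D_(0, y) f (a, x) = 'D_y (fun z => f (a, z)) x.
Proof.
move=> df; have dp : differentiable (fun z : V => (a, z)) x.
  exact: (differentiable_pair (differentiable_cst a x) _).
rewrite (derive_comp y dp df) derive_pair ?derive_cst ?derive_id //.
Qed.

Lemma derive_fst a x y : differentiable f (a, x) ->
  'D_(y, 0) f (a, x) = 'D_y (fun z => f (z, x)) a.
Proof.
move=> df; have dp : differentiable (fun z : U => (z, x)) a.
  exact: (differentiable_pair _ (differentiable_cst x a)).
rewrite (derive_comp y dp df) derive_pair ?derive_cst ?derive_id //.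
Qed.

End Partial.

(** * Symmetry of second derivatives *)

Section Schwarz.
Variables (R : realType) (V : normedModType R).

(** The mean value theorem in direction [v] turns the second difference into [t]
times an increment of ['D_v f] in direction [w], which is known up to o(t)
because ['D_v f] is differentiable at the one point [x]. *)
Lemma second_difference (f : V -> R) (x v w : V) :
  (\forall y \near x, differentiable f y) -> differentiable ('D_v f) x ->
  forall e : R, 0 < e -> \forall t \near 0^'+,
    `| (f (x + t *: v + t *: w) - f (x + t *: v)) - (f (x + t *: w) - f x)
       - t * t * 'D_w ('D_v f) x | <= e * (t * t).
Proof.
move=> df dg e e0; set g := 'D_v f.
(* [t * k] dominates the norms of the two increments of [x] together; the
   summand 1 keeps [k] positive when [v] and [w] vanish. *)
pose k := 2 * `|v| + `|w| + 1.
have k0 : 0 < k by rewrite /k ltr_wpDl // addr_ge0 // mulr_ge0.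
have ek0 : 0 < e / k by rewrite divr_gt0.
have /eqaddoP/(_ _ ek0) := diff_locally dg.
move=> /nbhs_ballP[d1 /= d10 B1].
have /nbhs_ballP[d2 /= d20 B2] := df.
have d12 : 0 < Num.min d1 d2 by rewrite lt_min d10.
near=> t.
have t0 : 0 < t by near: t; exact: nbhs_right_gt.
have tk : t * k < Num.min d1 d2.
  by rewrite -ltr_pdivlMr //; near: t; apply: nbhs_right_lt; rewrite divr_gt0.
have small (s : R) : 0 <= s <= t -> forall b : R, 0 <= b <= 1 ->
    `|s *: v + (b * t) *: w| <= t * (`|v| + `|w|) /\
    `|s *: v + (b * t) *: w| < Num.min d1 d2.
  move=> /andP[s0 st] b /andP[b0 b1].
  have L : `|s *: v + (b * t) *: w| <= t * (`|v| + `|w|).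
    rewrite (le_trans (ler_normD _ _)) // !normrZ (ger0_norm s0) mulrDr lerD //.
      by rewrite ler_wpM2r.
    by rewrite (ger0_norm b0) (gtr0_norm t0) ler_wpM2r // ler_piMl // ltW.
  split => //; apply: (le_lt_trans L); apply: le_lt_trans tk.
  by rewrite ler_pM2l // /k; have := normr_ge0 v; lra.
pose u (s : R) := f (x + s *: v + t *: w) - f (x + s *: v).
have du (s : R) : 0 <= s <= t ->
    is_derive s 1 u (g (x + s *: v + t *: w) - g (x + s *: v)).
  move=> st.
  have D (b : R) : 0 <= b <= 1 ->
      is_derive s 1 (fun s : R => f (x + s *: v + (b * t) *: w))
                    (g (x + s *: v + (b * t) *: w)).
    move=> b01.
    have da : differentiable (fun s : R => x + s *: v + (b * t) *: w) s.
      by [].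
    have dfs : differentiable f (x + s *: v + (b * t) *: w).
      apply: B2; rewrite -ball_normE /= -addrA opprD addNKr normrN.
      by have [_] := small s st b b01; rewrite lt_min => /andP[].
    split; first exact/diff_derivable/(differentiable_comp da dfs).
    rewrite (derive_comp (1 : R) da dfs) /g; congr ('D_ _ _ _).
    rewrite deriveE // diff_val !fctE /=.
    by rewrite !addr0 ?add0r scale1r.
  rewrite /u; apply: is_deriveB.
  - by have := D 1; rewrite mul1r; apply; rewrite ler01 lexx.
  - by have := D 0; rewrite mul0r scale0r; under eq_fun do rewrite addr0;
      rewrite addr0; apply; rewrite ler01 lexx.
(* [u s] is the increment of [f] in direction [w] based at [x + s v], so that
   the second difference is [u t - u 0]. *)
have [c ct Ec] : exists2 c, c \in `]0, t[%R &
    u t - u 0 = (g (x + c *: v + t *: w) - g (x + c *: v)) * (t - 0).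
  apply: (@MVT R u (fun s => g (x + s *: v + t *: w) - g (x + s *: v))) => //.
    by move=> s; rewrite in_itv /= => /andP[a b]; apply: du; rewrite !ltW.
  apply: derivable_within_continuous => s; rewrite in_itv /= => st.
  by have [] := du s st.
have ct' : 0 <= c <= t by move: ct; rewrite in_itv /= => /andP[a b]; rewrite !ltW.
have E : (f (x + t *: v + t *: w) - f (x + t *: v)) - (f (x + t *: w) - f x)
  = u t - u 0 by rewrite /u scale0r addr0.
rewrite E Ec subr0.
have A (b : R) : 0 <= b <= 1 ->
    `|g (x + c *: v + (b * t) *: w) - g x - 'd g x (c *: v + (b * t) *: w)|
    <= e / k * (t * (`|v| + (b * `|w|))).
  move=> b01; have [_ S2] := small c ct' b b01.
  have S1 : `|c *: v + (b * t) *: w| <= t * (`|v| + b * `|w|).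
    case/andP: ct' => c0 c1; case/andP: b01 => b0 b1.
    rewrite (le_trans (ler_normD _ _)) // !normrZ (ger0_norm c0) mulrDr lerD //.
      by rewrite ler_wpM2r.
    by rewrite (ger0_norm b0) (gtr0_norm t0) mulrA (mulrC b).
  apply: (@le_trans _ _ (e / k * `|c *: v + (b * t) *: w|)); last first.
    by rewrite ler_pM2l.
  have := B1 (c *: v + (b * t) *: w).
  rewrite -ball_normE /= sub0r normrN.
  move: S2; rewrite lt_min => /andP[S2 _] /(_ S2).
  by rewrite !fctE /= (addrC _ x) (addrA x) opprD (addrA ('D_v f _)).
have b0 : 0 <= (0 : R) <= 1 by rewrite lexx ler01.
have b1 : 0 <= (1 : R) <= 1 by rewrite lexx ler01.
have A1 := A 1 _; have A0 := A 0 _.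
rewrite mul1r ?mul0r ?scale0r ?addr0 ?mul1r in A1 A0.
have {A1} := A1 b1.
have {A0} := A0 b0.
have dZ : 'd g x (t *: w) = t * 'd g x w by rewrite linearZ.
rewrite linearD dZ (deriveE _ dg).
set a1 := g (x + c *: v + t *: w); set a2 := g (x + c *: v).
set l1 := 'd g x (c *: v); set l2 := 'd g x w.
move=> A0 A1.
set X := a1 - g x - (l1 + t * l2) - (a2 - g x - l1).
have -> : (a1 - a2) * t - t * t * l2 = t * X by rewrite /X; clear; ring.
rewrite normrM (gtr0_norm t0) mulrCA ler_pM2l //.
apply: (le_trans (ler_normB _ _)); apply: (le_trans (lerD A1 A0)).
have -> : e * t = e / k * (t * k) by rewrite (mulrC t) mulrA divfK // gt_eqF.
rewrite -mulrDr -mulrDr ler_pM2l // ler_pM2l // /k.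
by have := normr_ge0 v; have := normr_ge0 w; lra.
Unshelve. all: by end_near. Qed.

(** The second difference is symmetric in [v] and [w], so both mixed derivatives
are its limit after division by [t ^ 2]. *)
Lemma derive_sym_scalar (f : V -> R) (x v w : V) :
  (\forall y \near x, differentiable f y) ->
  differentiable ('D_v f) x -> differentiable ('D_w f) x ->
  'D_v ('D_w f) x = 'D_w ('D_v f) x.
Proof.
move=> df dv dw; apply/eqP; rewrite -subr_eq0 -normr_le0.
apply/ler_addgt0Pl => e e0; rewrite addr0.
have e20 : 0 < e / 2 by rewrite divr_gt0.
have P := second_difference w df dv e20.
have Q := second_difference v df dw e20.
have [t [t0 [A B]]] := filter_ex (filterI (nbhs_right_gt (0 : R)) (filterI P Q)).
move: B; rewrite (addrAC x) => B.
rewrite -(@ler_pM2l _ (t * t)) ?mulr_gt0 //.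
rewrite -[X in X * `|_|](ger0_norm (mulr_ge0 (ltW t0) (ltW t0))) -normrM.
move: A B; move: ('D_w _ _) ('D_v _ _) (f _) (f _) (f _) (f _) => a b f1 f2 f3 f4 A B.
have -> : t * t * (b - a) = (f4 - f3 - (f2 - f1) - t * t * a)
    - (f4 - f2 - (f3 - f1) - t * t * b) by ring.
apply: (le_trans (ler_normB _ _)); apply: (le_trans (lerD A B)).
have -> : t * t * e = e / 2 * (t * t) + e / 2 * (t * t) by field.
by [].
Qed.

End Schwarz.

(** * Derivatives in coordinates *)

Section RowVectors.
Variables (R : realType) (V W : normedModType R).

Lemma derive_row (n : nat) (f : V -> 'rV[R]_n) (x v : V) (i : 'I_n) :
  differentiable f x -> ('D_v f x) 0 i = 'D_v (fun y => f y 0 i) x.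
Proof. by move=> /diff_derivable df; rewrite derive_mx // mxE. Qed.

Lemma differentiable_row (n : nat) (f : V -> 'rV[R]_n) (x : V) :
  (forall i, differentiable (fun y => f y 0 i : R) x) -> differentiable f x.
Proof.
move=> df.
have -> : f = \sum_(i < n) (fun y => f y 0 i *: (delta_mx 0 i : 'rV[R]_n)).
  by apply/funext => y; rewrite fct_sumE [LHS]row_sum_delta.
by apply: differentiable_sum => i; apply: differentiableZl.
Qed.

Lemma differentiable_entry (n : nat) (f : V -> 'rV[R]_n) (x : V) i :
  differentiable f x -> differentiable (fun y => f y 0 i : R) x.
Proof.
move=> df; apply: (differentiable_comp df (differentiable_coord _ _ _)).
Qed.

Lemma derive_sum_delta (n : nat) (f : 'rV[R]_n -> W) (x y : 'rV[R]_n) :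
  differentiable f x ->
  'D_y f x = \sum_(i < n) y 0 i *: 'D_(delta_mx 0 i) f x.
Proof.
move=> df; rewrite deriveE // {1}[y]row_sum_delta linear_sum.
by apply: eq_bigr => i _; rewrite linearZ deriveE.
Qed.

Lemma functional_sum_delta (n : nat) (f : 'rV[R]_n -> R) (v : 'rV[R]_n) :
  (forall k u w, f (k *: u + w) = k * f u + f w) ->
  f v = \sum_(i < n) v 0 i * f (delta_mx 0 i).
Proof.
move=> flin.
have f0 : f 0 = 0.
  by have := flin (-1) 0 0; rewrite scaler0 addr0 mulN1r addNr.
have fD u w : f (u + w) = f u + f w by have := flin 1 u w; rewrite scale1r mul1r.
have fZ k u : f (k *: u) = k * f u by have := flin k u 0; rewrite f0 !addr0.
rewrite {1}[v]row_sum_delta (big_morph f fD f0).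
by apply: eq_bigr => i _; rewrite fZ.
Qed.

Lemma derive_sym (n : nat) (f : V -> 'rV[R]_n) (x v w : V) :
  (\forall y \near x, differentiable f y) ->
  differentiable ('D_v f) x -> differentiable ('D_w f) x ->
  'D_v ('D_w f) x = 'D_w ('D_v f) x.
Proof.
move=> df dv dw; apply/rowP => i.
apply: (etrans (derive_row v i dw)); apply/esym.
apply: (etrans (derive_row w i dv)); apply/esym.
have E u : \forall y \near x, 'D_u (fun z => f z 0 i) y = ('D_u f y) 0 i.
  by apply: filterS df => y dfy; rewrite (derive_row u i dfy).
have E' u : \forall y \near x, ('D_u f y) 0 i = 'D_u (fun z => f z 0 i) y.
  by apply: filterS df => y dfy; rewrite (derive_row u i dfy).
rewrite (near_eq_derive _ (E' v)) (near_eq_derive _ (E' w)).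
apply: derive_sym_scalar.
- by apply: filterS df => y; exact: differentiable_entry.
- exact: near_eq_differentiable (E' v) (differentiable_entry _ dv).
- exact: near_eq_differentiable (E' w) (differentiable_entry _ dw).
Qed.

End RowVectors.

Section Joint.
Variables (R : realType) (n m : nat).

(** Differentiability of every ['D_v f] at [x] gives that of the tangent map of
[f] in position and vector together, since [y] enters linearly and through
finitely many coordinates. *)
Lemma differentiable_derive_joint (f : 'rV[R]_n -> 'rV[R]_m) (x y : 'rV[R]_n) :
  (\forall z \near x, differentiable f z) ->
  (forall v, differentiable ('D_v f) x) ->
  differentiable (fun z : 'rV[R]_n * 'rV[R]_n => 'D_(z.2) f z.1) (x, y).
Proof.
move=> df dD.
pose g (z : 'rV[R]_n * 'rV[R]_n) := \sum_(i < n) z.2 0 i *: 'D_(delta_mx 0 i) f z.1.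
apply: (@near_eq_differentiable _ _ _ g).
  have : \forall z \near (x, y), differentiable f z.1 by exact: cvg_fst df.
  by apply: filterS => z dz; rewrite derive_sum_delta.
rewrite (_ : g = \sum_(i < n) (fun z : 'rV[R]_n * 'rV[R]_n =>
    z.2 0 i *: 'D_(delta_mx 0 i) f z.1)); last first.
  by apply/funext => z; rewrite fct_sumE.
apply: differentiable_sum => i; apply: differentiable_row => j.
rewrite (_ : (fun _ => _) = (fun z : 'rV[R]_n * 'rV[R]_n => z.2 0 i) *
    (fun z => ('D_(delta_mx 0 i) f z.1) 0 j)); last first.
  by apply/funext => z; rewrite mxE.
apply: differentiableM.
  exact: (differentiable_entry i (differentiable_snd _)).
apply: (differentiable_entry j).
exact: (differentiable_comp (differentiable_fst (x, y)) (dD _)).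
Qed.

End Joint.

Section Smooth.
Variables (R : realType) (V W : normedModType R) (A : set V) (f : V -> W).

Lemma smooth_on_differentiable x : smooth_on A f -> A x -> differentiable f x.
Proof. by move=> sf Ax; have [d _] := sf 1%N; exact: d. Qed.

Lemma smooth_on_derive v : smooth_on A f -> smooth_on A ('D_v f).
Proof. by move=> sf k; have [_ d] := sf k.+1; exact: d. Qed.

End Smooth.

(** * Derivatives of maps into a manifold *)

Section ManifoldMaps.
Variables (R : realType) (n : nat) (M : manifold R n).

(** The derivative is expressed in the chart of the value, which is how tangent
vectors are represented. Velocities, tangent maps and changes of chart are then
all instances of it, and the chain rule below covers them at once. *)
Definition mderive (V : normedModType R) (f : V -> M) (a v : V) : 'rV[R]_n :=
  'D_v (fun u => chart (f a) (f u)) a.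

(** Continuity is part of the notion: a chart says nothing about points outside
of its domain, so differentiability of the coordinates of [f] means something
only if [f] stays near [f a]. *)
Definition mdifferentiable (V : normedModType R) (f : V -> M) (a : V) : Prop :=
  {for a, continuous f} /\ differentiable (fun u => chart (f a) (f u)) a.

Lemma near_dom (T : topologicalType) (f : T -> M) (a : T) (p : M) :
  {for a, continuous f} -> dom p (f a) -> \forall u \near a, dom p (f u).
Proof.
move=> cf dpa; apply: cf.
exact: (open_nbhs_nbhs (conj (dom_open p) dpa)).
Qed.

Lemma near_img (p : M) (u : 'rV[R]_n) : img p u -> \forall w \near u, img p w.
Proof.
move=> pu; have oi : open (img p) := @img_open _ _ M p.
exact: (open_nbhs_nbhs (conj oi pu)).
Qed.

Lemma img_chart (p x : M) : dom p x -> img p (chart p x).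
Proof. by move=> px; exists x. Qed.

Lemma dom_chinv (p : M) u : img p u -> dom p (chinv p u).
Proof. by move=> [x px <-]; rewrite chartK. Qed.

Lemma chinvK (p : M) u : img p u -> chart p (chinv p u) = u.
Proof. by move=> [x px <-]; rewrite chartK. Qed.

Lemma transition_differentiable (p q : M) u : img p u -> dom q (chinv p u) ->
  differentiable (fun w => chart q (chinv p w)) u.
Proof.
move=> pu qu; apply: (smooth_on_differentiable (chart_compatible p q)).
by exists (chinv p u); [split => //; exact: dom_chinv|exact: chinvK].
Qed.

Variable V : normedModType R.
Implicit Types (f g : V -> M) (a v : V).

Lemma near_eq_mderive f g a v :
  (\near a, f a = g a) -> mderive f a v = mderive g a v.
Proof.
move=> fg; rewrite /mderive -(nbhs_singleton fg); apply: near_eq_derive.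
by apply: filterS fg => u ->.
Qed.

Lemma near_eq_mdifferentiable f g a :
  (\near a, f a = g a) -> mdifferentiable f a -> mdifferentiable g a.
Proof.
move=> fg [cf df]; have fga := nbhs_singleton fg; split.
  move=> A; rewrite -fga => /cf nA.
  by apply: filterS2 fg nA => u /= ->.
rewrite -fga; apply: near_eq_differentiable df.
by apply: filterS fg => u ->.
Qed.

Lemma mdifferentiable_chart f a p : mdifferentiable f a -> dom p (f a) ->
  differentiable (fun u => chart p (f u)) a.
Proof.
move=> [cf df] pfa; have xfa := dom_self (f a).
apply: (@near_eq_differentiable _ _ _
  ((fun u => chart p (chinv (f a) u)) \o (fun u => chart (f a) (f u)))).
  by apply: filterS (near_dom cf xfa) => u du /=; rewrite chartK.
apply: differentiable_comp df (transition_differentiable _ _).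
  exact: img_chart.
by rewrite chartK.
Qed.

Lemma derive_chart f a v p : mdifferentiable f a -> dom p (f a) ->
  'D_v (fun u => chart p (f u)) a = to_chart p (f a) (mderive f a v).
Proof.
move=> [cf df] pfa; have xfa := dom_self (f a).
rewrite /to_chart /mderive.
have E : \forall w \near a, chart p (f w) =
  ((fun u => chart p (chinv (f a) u)) \o (fun u => chart (f a) (f u))) w.
  by apply: filterS (near_dom cf xfa) => u du /=; rewrite chartK.
rewrite (near_eq_derive _ E) derive_comp //.
by apply: transition_differentiable; [exact: img_chart|rewrite chartK].
Qed.

Lemma mdifferentiable_of_chart f a p : {for a, continuous f} -> dom p (f a) ->
  differentiable (fun u => chart p (f u)) a -> mdifferentiable f a.
Proof.
move=> cf pfa df; split => //; have xfa := dom_self (f a).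
apply: (@near_eq_differentiable _ _ _
  ((fun u => chart (f a) (chinv p u)) \o (fun u => chart p (f u)))).
  by apply: filterS (near_dom cf pfa) => u du /=; rewrite chartK.
apply: differentiable_comp df (transition_differentiable _ _).
  exact: img_chart.
by rewrite chartK.
Qed.

Lemma mdifferentiable_cst (x : M) a : mdifferentiable (fun=> x) a.
Proof.
split; first exact: cst_continuous.
exact: differentiable_cst.
Qed.

Lemma mdifferentiable_comp (U : normedModType R) (h : U -> V) f (b : U) :
  differentiable h b -> mdifferentiable f (h b) -> mdifferentiable (f \o h) b.
Proof.
move=> dh [cf df]; split.
  exact: continuous_comp (differentiable_continuous dh) cf.
exact: differentiable_comp dh df.
Qed.

Lemma mderive_comp (U : normedModType R) (h : U -> V) f (b w : U) :
  differentiable h b -> mdifferentiable f (h b) ->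
  mderive (f \o h) b w = mderive f (h b) ('D_w h b).
Proof. by move=> dh [cf df]; apply: derive_comp dh df. Qed.

Lemma mderive_linear f a (k : R) v w : mdifferentiable f a ->
  mderive f a (k *: v + w) = k *: mderive f a v + mderive f a w.
Proof. by move=> [_ df]; exact: derive_dir_linear. Qed.

End ManifoldMaps.

Section ChartFrames.
Variables (R : realType) (n : nat) (M : manifold R n).

Lemma mdifferentiable_chinv (p : M) u : img p u -> mdifferentiable (chinv p) u.
Proof.
move=> pu; split; first exact: chinv_continuous.
exact: transition_differentiable (dom_self _).
Qed.

Lemma mderive_from_chart (V : normedModType R) (f : V -> M) (a v : V) (p : M) :
  mdifferentiable f a -> dom p (f a) ->
  mderive f a v = from_chart p (chart p (f a)) ('D_v (fun u => chart p (f u)) a).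
Proof.
move=> mf pfa.
have E : \forall w \near a, f w = (chinv p \o (fun u => chart p (f u))) w.
  by apply: filterS (near_dom mf.1 pfa) => u du /=; rewrite chartK.
rewrite (near_eq_mderive _ E) mderive_comp //.
  exact: mdifferentiable_chart.
exact: mdifferentiable_chinv (img_chart pfa).
Qed.

Lemma from_chart_linear (p : M) u (k : R) y z : img p u ->
  from_chart p u (k *: y + z) = k *: from_chart p u y + from_chart p u z.
Proof. by move=> pu; exact: (mderive_linear _ _ _ (mdifferentiable_chinv pu)). Qed.

(** Both sides are derivatives of [chinv x], which is the identity in the chart
of [x] itself. *)
Lemma to_chartK (p x : M) v : dom p x ->
  from_chart p (chart p x) (to_chart p x v) = v.
Proof.
move=> px; have xx := dom_self x; have ix := img_chart xx.
have E : chinv x (chart x x) = x by rewrite chartK.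
have m := mdifferentiable_chinv ix.
have pe : dom p (chinv x (chart x x)) by rewrite E.
have := mderive_from_chart v m pe; rewrite /mderive E -/(to_chart p x v) => <-.
have N : \forall u \near chart x x, chart x (chinv x u) = u.
  by apply: filterS (near_img ix) => u iu; rewrite chinvK.
by rewrite (near_eq_derive _ N) derive_id.
Qed.

Lemma from_chartK (p : M) u y : img p u ->
  to_chart p (chinv p u) (from_chart p u y) = y.
Proof.
move=> pu; have m := mdifferentiable_chinv pu.
rewrite -[from_chart _ _ _]/(mderive (chinv p) u y) -derive_chart //.
  have N : \forall w \near u, chart p (chinv p w) = w.
    by apply: filterS (near_img pu) => w iw; rewrite chinvK.
  by rewrite (near_eq_derive _ N) derive_id.
exact: dom_chinv.
Qed.

End ChartFrames.

Section SmoothMaps.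
Variables (R : realType) (l m n : nat).
Variables (L : manifold R l) (M : manifold R m) (N : manifold R n).

(** The chain rule for tangent maps: near [a], [F \o f] factors through the chart
at [f a]. *)
Lemma tangent_map_mderive (F : L -> N) (V : normedModType R) (f : V -> L)
    (a v : V) :
  mdifferentiable f a ->
  mdifferentiable (F \o chinv (f a)) (chart (f a) (f a)) ->
  tangent_map F (f a) (mderive f a v) = mderive (F \o f) a v.
Proof.
move=> mf mF; have xx := dom_self (f a).
have E : \forall w \near a, (F \o f) w =
    ((F \o chinv (f a)) \o (fun u => chart (f a) (f u))) w.
  by apply: filterS (near_dom mf.1 xx) => u du /=; rewrite chartK.
rewrite (near_eq_mderive _ E) (mderive_comp v mf.2 mF).
by rewrite /tangent_map /mderive /= chartK.
Qed.

Lemma smooth_map_mdifferentiable (F : L -> N) (V : normedModType R) (f : V -> L) a :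
  smooth_map F -> mdifferentiable f a -> mdifferentiable (F \o f) a.
Proof.
move=> [cF sF] mf; have xx := dom_self (f a).
have E : \forall w \near a,
    ((F \o chinv (f a)) \o (fun u => chart (f a) (f u))) w = (F \o f) w.
  by apply: filterS (near_dom mf.1 xx) => u du /=; rewrite chartK.
apply: near_eq_mdifferentiable E _.
apply: (@mdifferentiable_comp _ _ _ _ _ (fun u => chart (f a) (f u))
  (F \o chinv (f a))); first exact: mf.2.
have ix := img_chart xx.
apply: (@mdifferentiable_of_chart _ _ _ _ _ _ (F (f a))).
- apply: continuous_comp; last exact: cF.
  exact: chinv_continuous.
- by rewrite /= chartK //; exact: dom_self.
- apply: (smooth_on_differentiable (sF (f a) (F (f a)))); split => //.
  by rewrite chartK //; exact: dom_self.
Qed.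

Lemma smooth_map2_mdifferentiable (F : L -> M -> N) (V : normedModType R)
    (f : V -> L) (g : V -> M) (a : V) :
  smooth_map2 F -> mdifferentiable f a -> mdifferentiable g a ->
  mdifferentiable (fun z => F (f z) (g z)) a.
Proof.
move=> [cF sF] mf mg.
have xx := dom_self (f a); have yy := dom_self (g a).
have zz := dom_self (F (f a) (g a)).
apply: (@mdifferentiable_of_chart _ _ _ _ _ _ (F (f a) (g a))) => //.
  apply: (@continuous_comp _ _ _ (fun z => (f z, g z)) (fun z => F z.1 z.2)).
    by apply: cvg_pair; [exact: mf.1|exact: mg.1].
  exact: cF.
apply: (@near_eq_differentiable _ _ _
  ((fun w => chart (F (f a) (g a)) (F (chinv (f a) w.1) (chinv (g a) w.2))) \o
   (fun u => (chart (f a) (f u), chart (g a) (g u))))).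
  apply: filterS2 (near_dom mf.1 xx) (near_dom mg.1 yy) => u du dv /=.
  by rewrite !chartK.
apply: differentiable_comp; first exact: differentiable_pair mf.2 mg.2.
apply: (smooth_on_differentiable (sF _ _ _)).
by split; rewrite /= ?chartK //; exact: img_chart.
Qed.

End SmoothMaps.

Section Curves.
Variables (R : realType) (n : nat) (M : manifold R n).

Lemma smooth_curve_mdifferentiable (c : R -> M) t :
  smooth_curve c -> mdifferentiable c t.
Proof.
move=> [cc sc]; split; first exact: cc.
apply: (smooth_on_differentiable (sc (c t))); exact: dom_self.
Qed.

Lemma velocityE (c : R -> M) t : velocity c t = mderive c t 1.
Proof. by rewrite /velocity derive1E. Qed.

End Curves.

(** * Euler-Lagrange equations along the orbit of a symmetry *)

(** The symmetry is a one-parameter family of local maps [m (k r, .)], where [k]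
is the coordinate expression of a one-parameter group through [e]; its generator
is [xi], and [u] is an integral curve of [xi]. The Lagrangian [L] need only be
differentiable at one point: moving everything back to time [t] by the symmetry
leaves the derivative of [L] at [(u t, xi (u t))] as the only one that occurs. *)
Section Noether.
Variables (R : realType) (l n : nat).
Variables (m : 'rV[R]_l * 'rV[R]_n -> 'rV[R]_n) (O : set ('rV[R]_l * 'rV[R]_n)).
Variables (e Y : 'rV[R]_l) (k : R -> 'rV[R]_l) (u : R -> 'rV[R]_n) (t : R).
Variable L : 'rV[R]_n -> 'rV[R]_n -> R.

Let xi x := 'D_(Y, 0) m (e, x).

Hypothesis O_near : \forall z \near (e, u t), O z.
Hypothesis smooth_m : smooth_on O m.
Hypothesis k0 : k 0 = e.
Hypothesis dk : differentiable k 0.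
Hypothesis k'0 : 'D_1 k 0 = Y.
Hypothesis du : \forall s \near t, differentiable u s.
Hypothesis u't : derive1 u t = xi (u t).
Hypothesis flow_u :
  \forall s \near t, \forall r \near s, m (k (t - s), u r) = u (r + (t - s)).
Hypothesis m_id : \forall x \near u t, m (e, x) = x.
Hypothesis L_inv :
  \forall s \near t, forall y, L (u s) y = L (u t) ('D_(0, y) m (k (t - s), u s)).
Hypothesis dL :
  differentiable (fun z : 'rV[R]_n * 'rV[R]_n => L z.1 z.2) (u t, xi (u t)).

Let Oeu : O (e, u t).
Proof. exact: nbhs_singleton O_near. Qed.

Let dm z : O z -> differentiable m z.
Proof. exact: smooth_on_differentiable smooth_m. Qed.

Let dDm v z : O z -> differentiable ('D_v m) z.
Proof. by apply: smooth_on_differentiable; exact: smooth_on_derive. Qed.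

Let dpath : differentiable (fun s : R => (k (t - s), u s)) t.
Proof.
apply: differentiable_pair; last exact: nbhs_singleton du.
apply: (@differentiable_comp _ _ _ _ (fun s => t - s) k).
  exact: differentiableB.
by rewrite subrr.
Qed.

Let nearO : \forall s \near t, O (k (t - s), u s).
Proof.
apply: (differentiable_continuous dpath).
by rewrite subrr k0; exact: O_near.
Qed.

Let dxi : differentiable xi (u t).
Proof.
apply: (@differentiable_comp _ _ _ _ (fun x => (e, x)) ('D_(Y, 0) m)).
  exact: (differentiable_pair (differentiable_cst e _) _).
exact: dDm.
Qed.

Let dL2 : differentiable (L (u t)) (xi (u t)).
Proof.
apply: (@differentiable_comp _ _ _ _ (fun y => (u t, y)) (fun z => L z.1 z.2)) => //.
Qed.

(** Conservation of momentum. The symmetry for time [t - s] carries [u s] to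
[u t], hence carries the velocity at [s] to the velocity at [t]; by invariance
the momentum at [s] is the momentum at [t] applied to the image of [v]. *)
Lemma momentum_pullback v : \forall s \near t,
  'D_v (L (u s)) (derive1 u s) = 'D_('D_(0, v) m (k (t - s), u s)) (L (u t)) (xi (u t)).
Proof.
near=> s.
have dms : differentiable m (k (t - s), u s) by apply: dm; near: s; exact: nearO.
have dus : differentiable u s by near: s; exact: du.
pose B y := 'D_(0, y) m (k (t - s), u s).
have linB : linear B.
  move=> c y z; apply: etrans (derive_dir_linear _ _ c dms); congr ('D_ _ _ _).
  by rewrite [RHS]surjective_pairing /= scaler0 addr0.
have LE : L (u s) = L (u t) \o B.
  by apply/funext => y; rewrite /B /=; move: y; near: s; exact: L_inv.
have Bu : B (derive1 u s) = xi (u t).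
  have flow_s : \forall r \near s, m (k (t - s), u r) = u (r + (t - s)).
    by near: s; exact: flow_u.
  have dpair : differentiable (fun r : R => (k (t - s), u r)) s.
    exact: (differentiable_pair (differentiable_cst _ s) dus).
  have -> : B (derive1 u s) = 'D_1 (fun r => m (k (t - s), u r)) s.
    apply: etrans (esym (derive_comp (1 : R) dpair dms)); congr ('D_ _ _ _).
    apply: etrans (esym (derive_pair _ (differentiable_cst _ s) dus)).
    by rewrite derive_cst derive1E.
  have st : s + (t - s) = t by rewrite addrC subrK.
  have dut : differentiable u (s + (t - s)) by rewrite st; exact: nbhs_singleton du.
  have dsh : differentiable (fun r : R => r + (t - s)) s by [].
  rewrite (near_eq_derive _ flow_s) (derive_comp (1 : R) dsh dut).
  have -> : 'D_1 (fun r : R => r + (t - s)) s = 1.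
    rewrite -[LHS]/('D_1 (id + cst (t - s)) s) deriveD //.
    by rewrite derive_id derive_cst addr0.
  by rewrite st -u't derive1E.
by rewrite LE (derive_comp_linear _ _ _ linB) Bu.
Unshelve. all: by end_near. Qed.

(** At time 0 the flow is the identity near [u t], so its spatial derivative is
constant. *)
Lemma derive_flow_id v : 'D_(0, xi (u t)) ('D_(0, v) m) (e, u t) = 0.
Proof.
have Ot : \forall x \near u t, O (e, x).
  have dp : differentiable (fun x : 'rV[R]_n => (e, x)) (u t).
    exact: (differentiable_pair (differentiable_cst e _) _).
  apply: (differentiable_continuous dp); exact: O_near.
have E : \forall x \near u t, 'D_(0, v) m (e, x) = v.
  apply: filterS2 (nbhs_interior m_id) Ot => x mx Ox.
  rewrite derive_snd; last exact: dm.
  by rewrite (near_eq_derive _ mx) derive_id.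
rewrite derive_snd; last exact: dDm.
by rewrite (near_eq_derive _ E) derive_cst.
Qed.

Let pathE : (k (t - t), u t) = (e, u t).
Proof. by rewrite subrr k0. Qed.

Lemma derive_path : 'D_1 (fun s : R => (k (t - s), u s)) t = - (Y, 0) + (0, xi (u t)).
Proof.
have dsub : differentiable (fun s : R => t - s) t by exact: differentiableB.
have dk' : differentiable k (t - t) by rewrite subrr.
have dc : differentiable (k \o (fun s : R => t - s)) t.
  exact: differentiable_comp dsub dk'.
apply: etrans (derive_pair _ dc (nbhs_singleton du)) _.
have -> : 'D_1 (k \o (fun s : R => t - s)) t = - Y.
  apply: etrans (derive_comp (1 : R) dsub dk') _.
  have -> : 'D_1 (fun s : R => t - s) t = - 1.
    rewrite -[LHS]/('D_1 (cst t - id) t) deriveB //.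
    by rewrite derive_id derive_cst sub0r.
  rewrite subrr -k'0 deriveE // [in RHS]deriveE // -linearN //.
by rewrite -derive1E u't [RHS]surjective_pairing /= oppr0 addr0 add0r.
Qed.

(** The variation of the spatial derivative of the flow is the spatial derivative
of its generator, by symmetry of second derivatives. *)
Lemma derive_pullback v :
  'D_1 (fun s => 'D_(0, v) m (k (t - s), u s)) t = - 'D_v xi (u t).
Proof.
have dD : differentiable ('D_(0, v) m) (k (t - t), u t) by rewrite pathE; exact: dDm.
apply: etrans (derive_comp (1 : R) dpath dD) _.
rewrite derive_path pathE.
apply: etrans (derive_dirD _ _ (dDm _ Oeu)) _.
apply: etrans (congr1 (+%R^~ _) (derive_dirN _ (dDm _ Oeu))) _.
apply: etrans (congr1 (+%R _) (derive_flow_id v)) _.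
apply: etrans (addr0 _) (congr1 -%R _).
have nO : \forall z \near (e, u t), differentiable m z.
  by apply: filterS O_near => z; exact: dm.
apply: etrans (derive_sym nO (dDm _ Oeu) (dDm _ Oeu)) _.
by apply: derive_snd; exact: dDm.
Qed.

Lemma momentum_derivative v :
  is_derive t 1 (fun s => 'D_v (L (u s)) (derive1 u s))
    (- 'D_('D_v xi (u t)) (L (u t)) (xi (u t))).
Proof.
have E : \forall s \near t,
    ('d (L (u t)) (xi (u t)) \o (fun s => 'D_(0, v) m (k (t - s), u s))) s =
    'D_v (L (u s)) (derive1 u s).
  by apply: filterS (momentum_pullback v) => s ->; rewrite deriveE.
apply: near_eq_is_derive E _.
have dB : differentiable (fun s => 'D_(0, v) m (k (t - s), u s)) t.
  apply: (@differentiable_comp _ _ _ _ (fun s => (k (t - s), u s)) ('D_(0, v) m)) => //.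
  by rewrite pathE; exact: dDm.
have dl : differentiable ('d (L (u t)) (xi (u t))) ('D_(0, v) m (k (t - t), u t)).
  by apply: linear_differentiable; exact: (diff_continuous dL2).
split; first exact/diff_derivable/(differentiable_comp dB dl).
apply: etrans (derive_comp (1 : R) dB dl) _.
rewrite derive_pullback.
apply: etrans (deriveE _ dl) _.
rewrite diff_lin; last exact: (diff_continuous dL2).
exact: etrans (esym (deriveE _ dL2)) (derive_dirN _ dL2).
Qed.

Lemma derive_energy v :
  'D_v (fun x => L x (xi x)) (u t) =
  'D_v (fun x => L x (xi (u t))) (u t) + 'D_('D_v xi (u t)) (L (u t)) (xi (u t)).
Proof.
pose L' (z : 'rV[R]_n * 'rV[R]_n) := L z.1 z.2.
have dp : differentiable (fun x => (x, xi x)) (u t) by exact: differentiable_pair.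
have dq : differentiable (fun x : 'rV[R]_n => (x, xi (u t))) (u t).
  exact: (differentiable_pair _ (differentiable_cst _ _)).
have dr : differentiable (fun y : 'rV[R]_n => (u t, y)) (xi (u t)).
  exact: (differentiable_pair (differentiable_cst _ _) _).
apply: etrans (derive_comp (f := L') v dp dL) _.
have -> : 'D_v (fun x => L x (xi (u t))) (u t) = 'D_(v, 0) L' (u t, xi (u t)).
  apply: etrans (derive_comp (f := L') v dq dL) _; congr ('D_ _ _ _).
  by rewrite derive_pair // derive_id derive_cst.
have -> : 'D_('D_v xi (u t)) (L (u t)) (xi (u t)) =
    'D_(0, 'D_v xi (u t)) L' (u t, xi (u t)).
  apply: etrans (derive_comp (f := L') ('D_v xi (u t)) dr dL) _; congr ('D_ _ _ _).
  by rewrite derive_pair // derive_id derive_cst.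
apply: etrans _ (derive_dirD (v, 0) (0, 'D_v xi (u t)) dL); congr ('D_ _ _ _).
rewrite derive_pair // derive_id [RHS]surjective_pairing /=.
by rewrite addr0 add0r.
Qed.

(** With momentum p = L_y(u, xi), the previous lemmas say that the time derivative
of p(v) is - p(D_v xi), and that the energy L(x, xi(x)) has derivative
L_x(v) + p(D_v xi) at [u t]. The Euler-Lagrange expression, the derivative of p(v)
minus L_x(v), is therefore minus the derivative of the energy. *)
Lemma euler_lagrange_orbit v :
  is_derive t 1 (fun s => 'D_v (L (u s)) (derive1 u s))
    ('D_v (fun x => L x (derive1 u t)) (u t)) <->
  'D_v (fun x => L x (xi x)) (u t) = 0.
Proof.
rewrite derive_energy u't; have md := momentum_derivative v.
split=> [[_ E]|/eqP].
  by move: E; rewrite (derive_val (is_derive := md)) => <-; rewrite addNr.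
by rewrite addr_eq0 => /eqP ->.
Qed.

End Noether.

(** * The energy of an (alpha, beta)-metric *)

Section AlphaBeta.
Variables (R : realType) (V : normedModType R).
Implicit Types (A B : V -> R) (phi : R -> R) (z v : V).

Lemma derive_comp_scalar phi (g : V -> R) z v :
  differentiable g z -> differentiable phi (g z) ->
  'D_v (phi \o g) z = derive1 phi (g z) * 'D_v g z.
Proof.
move=> dg dphi; apply: etrans (derive_comp v dg dphi) _.
have := derive_dir_linear (1 : R) 0 ('D_v g z) dphi.
rewrite derive0 !addr0 -[_ *: 1]/('D_v g z * 1) mulr1 => ->.
by rewrite derive1E mulrC.
Qed.

Lemma differentiable_sqrt A z : 0 < A z -> differentiable A z ->
  differentiable (fun x => Num.sqrt (A x)) z.
Proof.
move=> A0 dA; apply: (@differentiable_comp _ _ _ _ A) => //.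
by apply/derivable1_diffP; have [] := is_derive1_sqrt A0.
Qed.

(** Half the square of the (alpha, beta)-metric as a function of [a = alpha ^ 2]
and [b = beta]. *)
Definition ab_energy phi (a b : R) : R :=
  2^-1 * (Num.sqrt a * phi (b / Num.sqrt a)) ^+ 2.

Lemma differentiable_ratio A B z : 0 < A z -> differentiable A z ->
  differentiable B z -> differentiable (fun x => B x / Num.sqrt (A x)) z.
Proof.
move=> A0 dA dB; apply: differentiableM => //.
apply: differentiableV; first exact: differentiable_sqrt.
by rewrite gt_eqF // sqrtr_gt0.
Qed.

Section Energy.
Variables (phi : R -> R) (A B : V -> R) (z : V).
Hypotheses (A0 : 0 < A z) (dA : differentiable A z) (dB : differentiable B z).
Let s := B z / Num.sqrt (A z).
Hypothesis dphi : differentiable phi s.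

Let q x := Num.sqrt (A x).
Let dq : differentiable q z. Proof. exact: differentiable_sqrt. Qed.
Let q0 : 0 < q z. Proof. by rewrite sqrtr_gt0. Qed.
Let dr : differentiable (fun x => B x / q x) z.
Proof. exact: differentiable_ratio. Qed.
Let dpr : differentiable (phi \o (fun x => B x / q x)) z.
Proof. exact: differentiable_comp dr dphi. Qed.

Lemma differentiable_ab_energy : differentiable (fun x => ab_energy phi (A x) (B x)) z.
Proof.
pose F := q * (phi \o (fun x => B x / q x)).
have dF : differentiable F z by exact: differentiableM.
exact: (@differentiableZ _ _ _ (F ^+ 2) 2^-1 z (differentiableX _ dF)).
Qed.

(** With q = alpha and s = beta / q one has
d (q phi s) = (phi s - s phi' s) dq + (phi' s) dbeta. Where dbeta = 0 the energy
of the (alpha, beta)-metric therefore varies like that of alpha. *)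
Lemma derive_ab_energy v : 'D_v B z = 0 ->
  'D_v (fun x => ab_energy phi (A x) (B x)) z =
  phi s * (phi s - s * derive1 phi s) * 'D_v (fun x => 2^-1 * Num.sqrt (A x) ^+ 2) z.
Proof.
move=> B0.
pose F := q * (phi \o (fun x => B x / q x)).
have dF : differentiable F z by exact: differentiableM.
have derq (G : V -> R) : differentiable G z ->
    'D_v (fun x => 2^-1 * G x ^+ 2) z = G z * 'D_v G z.
  move=> dG; rewrite -[LHS]/('D_v (2^-1 *: (G ^+ 2)) z).
  have dd : derivable G z v by exact: diff_derivable.
  rewrite deriveZ; last exact: derivableX.
  rewrite deriveX // expr1 -[LHS]/(2^-1 * (2%:R * G z * 'D_v G z)).
  by rewrite !mulrA mulVf ?mul1r // pnatr_eq0.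
rewrite -[LHS]/('D_v (fun x => 2^-1 * F x ^+ 2) z) !derq //.
have -> : 'D_v F z = (phi s - s * derive1 phi s) * 'D_v q z.
  rewrite deriveM; [|exact: diff_derivable..].
  rewrite derive_comp_scalar // -/s.
  have -> : 'D_v (fun x => B x / q x) z = - s / q z * 'D_v q z.
    rewrite -[LHS]/('D_v (B * (fun x => (q x)^-1)) z).
    rewrite deriveM; [|exact: diff_derivable|]; last first.
      by apply: derivableV; [rewrite gt_eqF|exact: diff_derivable].
    rewrite B0 scaler0 addr0 deriveV; [|by rewrite gt_eqF|exact: diff_derivable].
    rewrite -[LHS]/(B z * (- (q z) ^- 2 * 'D_v q z)) /s -/(q z).
    by field; rewrite gt_eqF.
  rewrite -[LHS]/(q z * (derive1 phi s * (- s / q z * 'D_v q z)) + phi s * 'D_v q z).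
  by field; rewrite gt_eqF.
rewrite -[F z]/(q z * phi s) -/(q z).
by rewrite -[X in _ = _ * (_ * X)]/('D_v q z); ring.
Qed.

End Energy.
End AlphaBeta.

(** Evaluate [b] on [x - (b x y / b y y) y]. *)
Lemma cauchy_schwarz_form (R : realType) (W : lmodType R) (b : W -> W -> R) (x y : W) :
  (forall k u v w, b (k *: u + v) w = k * b u w + b v w) ->
  (forall u v, b u v = b v u) -> (forall u, 0 <= b u u) -> 0 < b y y ->
  `|b x y / Num.sqrt (b y y)| <= Num.sqrt (b x x).
Proof.
move=> lin sym pos y0.
have linr k u v w : b w (k *: u + v) = k * b w u + b w v by rewrite sym lin !(sym w).
pose c := - (b x y / b y y).
have := pos (c *: y + x).
rewrite lin !linr (sym y x) => P.
have {}P : b x y ^+ 2 / b y y <= b x x.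
  rewrite -subr_ge0; apply: le_trans P _; rewrite le_eqVlt; apply/orP; left; apply/eqP.
  by rewrite /c; field; rewrite gt_eqF.
rewrite -sqrtr_sqr expr_div_n sqr_sqrtr; last exact: ltW.
by rewrite ler_wsqrtr.
Qed.

(** * Metrics and fields in a chart *)

Section MetricInCharts.
Variables (R : realType) (n : nat) (M : manifold R n).
Variable (a : M -> 'rV[R]_n -> 'rV[R]_n -> R).
Hypothesis ra : riemannian_metric a.

Lemma metric_linear_r x k u v w : a x w (k *: u + v) = k * a x w u + a x w v.
Proof. by rewrite (rm_sym ra) (rm_linear ra) (rm_sym ra x u) (rm_sym ra x v). Qed.

Lemma metric_chart_sum (p : M) x (v w : 'rV[R]_n) : img p x ->
  a (chinv p x) (from_chart p x v) (from_chart p x w) =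
  \sum_(i < n) \sum_(j < n) v 0 i * w 0 j *
    a (chinv p x) (from_chart p x (delta_mx 0 i)) (from_chart p x (delta_mx 0 j)).
Proof.
move=> px.
rewrite (@functional_sum_delta _ _
  (fun v => a (chinv p x) (from_chart p x v) (from_chart p x w))).
  apply: eq_bigr => i _.
  rewrite (@functional_sum_delta _ _ (fun w => a (chinv p x) _ (from_chart p x w))).
    by rewrite mulr_sumr; apply: eq_bigr => j _; rewrite mulrA.
  by move=> k u w'; rewrite from_chart_linear // metric_linear_r.
by move=> k u w'; rewrite from_chart_linear // (rm_linear ra).
Qed.

(** Smoothness of the metric is given for constant coordinate vectors only;
bilinearity reduces the general case to it. *)
Lemma differentiable_metric_along (V : normedModType R) (p : M)
    (P v w : V -> 'rV[R]_n) (z : V) :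
  differentiable P z -> differentiable v z -> differentiable w z -> img p (P z) ->
  differentiable
    (fun y => a (chinv p (P y)) (from_chart p (P y) (v y)) (from_chart p (P y) (w y))) z.
Proof.
move=> dP dv dw pz.
pose g i j x :=
  a (chinv p x) (from_chart p x (delta_mx 0 i)) (from_chart p x (delta_mx 0 j)).
have dg i j : differentiable (g i j \o P) z.
  apply: differentiable_comp dP _.
  exact: (smooth_on_differentiable (rm_smooth ra p (delta_mx 0 i) (delta_mx 0 j))).
apply: (@near_eq_differentiable _ _ _
  (\sum_(i < n) \sum_(j < n) ((fun y => v y 0 i) * (fun y => w y 0 j) * (g i j \o P)))).
  have : \forall y \near z, img p (P y).
    exact: (differentiable_continuous dP (near_img pz)).
  apply: filterS => y py; rewrite metric_chart_sum // fct_sumE; apply: eq_bigr => i _.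
  by rewrite fct_sumE.
apply: differentiable_sum => i; apply: differentiable_sum => j.
apply: differentiableM => //; apply: differentiableM; exact: differentiable_entry.
Qed.

Variable X : M -> 'rV[R]_n.
Hypothesis sX : smooth_field X.

Definition alpha2_chart (p : M) (z : 'rV[R]_n * 'rV[R]_n) : R :=
  a (chinv p z.1) (from_chart p z.1 z.2) (from_chart p z.1 z.2).

Definition beta_chart (p : M) (z : 'rV[R]_n * 'rV[R]_n) : R :=
  a (chinv p z.1) (X (chinv p z.1)) (from_chart p z.1 z.2).

Lemma differentiable_alpha2 (p : M) z : img p z.1 -> differentiable (alpha2_chart p) z.
Proof.
move=> pz; apply: differentiable_metric_along => //.
- exact: differentiable_fst.
- exact: differentiable_snd.
- exact: differentiable_snd.
Qed.

Lemma field_in_chartK (p : M) x : img p x ->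
  from_chart p x (field_in_chart X p x) = X (chinv p x).
Proof. by move=> px; rewrite -{1}(chinvK px) to_chartK //; exact: dom_chinv. Qed.

Lemma differentiable_beta (p : M) z : img p z.1 -> differentiable (beta_chart p) z.
Proof.
move=> pz; have dX : differentiable (field_in_chart X p \o fst) z.
  apply: differentiable_comp; first exact: differentiable_fst.
  exact: (smooth_on_differentiable (sX p)).
have := differentiable_metric_along (differentiable_fst z) dX (differentiable_snd z) pz.
apply: near_eq_differentiable.
have : \forall y \near z, img p y.1.
  exact: (differentiable_continuous (differentiable_fst z) (near_img pz)).
by apply: filterS => y py; rewrite /beta_chart -field_in_chartK.
Qed.

Lemma metric_ge0 x u : 0 <= a x u u.
Proof.
have [->|u0] := eqVneq u 0; last exact: ltW (rm_pos ra x u0).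
by have := rm_linear ra x (-1) 0 0 0; rewrite scaler0 addr0 mulN1r addNr => ->.
Qed.

End MetricInCharts.

(** * Lie groups in the chart at the identity *)

Section GroupLaws.
Variables (R : realType) (N : nat) (G : lie_group R N).
Implicit Types g k : G.

Lemma lg_mulVr g : lg_mul g (lg_inv g) = lg_one G.
Proof.
rewrite -[LHS]lg_mul1 -(lg_mulV (lg_inv g)) -lg_mulA (lg_mulA (lg_inv g)) lg_mulV.
by rewrite lg_mul1.
Qed.

Lemma lg_mulr1 g : lg_mul g (lg_one G) = g.
Proof. by rewrite -(lg_mulV g) lg_mulA lg_mulVr lg_mul1. Qed.

Lemma lg_inv1 : lg_inv (lg_one G) = lg_one G.
Proof. by rewrite -[LHS]lg_mulr1 lg_mulV. Qed.

Section OneParameter.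
Variables (c : R -> G) (Y : 'rV[R]_N).
Hypothesis cY : is_exp c Y.

Lemma is_expD s t : c (s + t) = lg_mul (c s) (c t).
Proof. by case: cY. Qed.

Lemma is_exp0 : c 0 = lg_one G.
Proof.
have E : lg_mul (c 0) (c 0) = c 0 by rewrite -is_expD addr0.
by rewrite -[LHS]lg_mul1 -(lg_mulV (c 0)) -lg_mulA E.
Qed.

Lemma is_exp_mdifferentiable t : mdifferentiable c t.
Proof. by case: cY => sc _ _; exact: smooth_curve_mdifferentiable. Qed.

Lemma is_exp_mderive : mderive c 0 1 = Y.
Proof. by rewrite -velocityE; case: cY. Qed.

Lemma derive_exp_chart : 'D_1 (fun s => chart (lg_one G) (c s)) 0 = Y.
Proof. by rewrite -is_exp_mderive /mderive is_exp0. Qed.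

End OneParameter.
End GroupLaws.

Section TangentMaps.
Variables (R : realType) (m n : nat) (M : manifold R m) (P : manifold R n).

Lemma tangent_mapE (F : M -> P) x v :
  tangent_map F x v = mderive (F \o chinv x) (chart x x) v.
Proof. by rewrite /tangent_map /mderive /= chartK //; exact: dom_self. Qed.

Lemma chinv_self (x : M) : chinv x (chart x x) = x.
Proof. by rewrite chartK //; exact: dom_self. Qed.

Lemma img_self (x : M) : img x (chart x x).
Proof. exact: img_chart (dom_self x). Qed.

Lemma mderive_chinv_self (x : M) v : mderive (chinv x) (chart x x) v = v.
Proof.
rewrite /mderive chinv_self.
have E : \forall u \near chart x x, chart x (chinv x u) = u.
  by apply: filterS (near_img (img_self x)) => u; exact: chinvK.
by rewrite (near_eq_derive _ E) derive_id.
Qed.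

End TangentMaps.

Lemma near_chart_dom2 (R : realType) (l m n : nat) (L : manifold R l)
    (M : manifold R m) (P : manifold R n) (F : L -> M -> P) (p : L) (q : M) (r : P) x y :
  smooth_map2 F -> img p x -> img q y -> dom r (F (chinv p x) (chinv q y)) ->
  \forall w \near (x, y), [/\ img p w.1, img q w.2 &
                     dom r (F (chinv p w.1) (chinv q w.2))].
Proof.
move=> sF px qy rF.
have mF : mdifferentiable
    (fun w : 'rV[R]_l * 'rV[R]_m => F (chinv p w.1) (chinv q w.2)) (x, y).
  apply: smooth_map2_mdifferentiable sF _ _.
    apply: (@mdifferentiable_comp _ _ _ _ _ fst (chinv p)).
      exact: differentiable_fst.
    exact: mdifferentiable_chinv.
  apply: (@mdifferentiable_comp _ _ _ _ _ snd (chinv q)).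
    exact: differentiable_snd.
  exact: mdifferentiable_chinv.
have n1 : \forall w \near (x, y), img p w.1 by exact: cvg_fst (near_img px).
have n2 : \forall w \near (x, y), img q w.2 by exact: cvg_snd (near_img qy).
have n3 := near_dom mF.1 rF.
by apply: filterS3 n1 n2 n3 => w.
Qed.

Section LieBracket.
Variables (R : realType) (N : nat) (G : lie_group R N).

Let one := lg_one G.
Let e := chart one one.
Let mul_chart (w : 'rV[R]_N * 'rV[R]_N) :=
  chart one (lg_mul (chinv one w.1) (chinv one w.2)).
Let O := [set w : 'rV[R]_N * 'rV[R]_N | [/\ img one w.1, img one w.2 &
                     dom one (lg_mul (chinv one w.1) (chinv one w.2))]].

(** Coordinates of the right-invariant and of the left-invariant field with value
[Y] at the identity. *)
Definition right_field_chart (Y x : 'rV[R]_N) := 'D_(Y, 0) mul_chart (e, x).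
Definition left_field_chart (Y x : 'rV[R]_N) := 'D_(0, Y) mul_chart (x, e).

Let smooth_mul : smooth_on O mul_chart.
Proof. by have [_] := lg_mul_smooth G; exact. Qed.

Let nearO : \forall w \near (e, e), O w.
Proof.
apply: near_chart_dom2; [exact: lg_mul_smooth|exact: img_self|exact: img_self|].
by rewrite chinv_self lg_mul1; exact: dom_self.
Qed.

Let Oee : O (e, e). Proof. exact: nbhs_singleton nearO. Qed.

Let dpair_l (x y : 'rV[R]_N) : differentiable (fun z : 'rV[R]_N => (z, y)) x.
Proof. exact: (differentiable_pair _ (differentiable_cst _ _)). Qed.

Let dpair_r (x y : 'rV[R]_N) : differentiable (fun z : 'rV[R]_N => (x, z)) y.
Proof. exact: (differentiable_pair (differentiable_cst _ _) _). Qed.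

Let O_right x : img one x -> O (e, x).
Proof.
move=> ix; split; rewrite /= ?chinv_self ?lg_mul1 //; first exact: img_self.
exact: dom_chinv.
Qed.

Let O_left x : img one x -> O (x, e).
Proof.
move=> ix; split; rewrite /= ?chinv_self ?lg_mulr1 //; first exact: img_self.
exact: dom_chinv.
Qed.

Lemma differentiable_right_field Y : differentiable (right_field_chart Y) e.
Proof.
apply: (@differentiable_comp _ _ _ _ (fun x => (e, x)) ('D_(Y, 0) mul_chart)) => //.
by apply: smooth_on_differentiable Oee; exact: smooth_on_derive.
Qed.

Lemma differentiable_left_field Y : differentiable (left_field_chart Y) e.
Proof.
apply: (@differentiable_comp _ _ _ _ (fun x => (x, e)) ('D_(0, Y) mul_chart)) => //.
by apply: smooth_on_differentiable Oee; exact: smooth_on_derive.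
Qed.

Lemma right_field_mderive Y x (n : nat) (M : manifold R n) (f : G -> M) :
  img one x -> mdifferentiable (f \o chinv one) x ->
  mderive (f \o chinv one) x (right_field_chart Y x) =
  mderive (fun y => f (lg_mul (chinv one y) (chinv one x))) e Y.
Proof.
move=> ix mf; have Oex := O_right ix.
have dm : differentiable mul_chart (e, x).
  exact: smooth_on_differentiable smooth_mul Oex.
have dml : differentiable (fun y => mul_chart (y, x)) e.
  exact: differentiable_comp (dpair_l e x) dm.
have ml : mul_chart (e, x) = x by rewrite /mul_chart /= chinv_self lg_mul1 chinvK.
have mf' : mdifferentiable (f \o chinv one) (mul_chart (e, x)) by rewrite ml.
have -> : mderive (f \o chinv one) x (right_field_chart Y x) =
  mderive (f \o chinv one) (mul_chart (e, x)) ('D_Y (fun y => mul_chart (y, x)) e).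
  by rewrite ml /right_field_chart derive_fst.
rewrite -(mderive_comp _ dml mf'); apply: near_eq_mderive.
have : \forall y \near e, O (y, x).
  have [/= ie _ dx] := Oex.
  exact: (differentiable_continuous (dpair_l e x)
    (near_chart_dom2 (lg_mul_smooth G) ie ix dx)).
by apply: filterS => y [/= _ _ dy]; rewrite /mul_chart /= chartK.
Qed.

Lemma left_field_mderive Y x (n : nat) (M : manifold R n) (f : G -> M) :
  img one x -> mdifferentiable (f \o chinv one) x ->
  mderive (f \o chinv one) x (left_field_chart Y x) =
  mderive (fun y => f (lg_mul (chinv one x) (chinv one y))) e Y.
Proof.
move=> ix mf; have Oxe := O_left ix.
have dm : differentiable mul_chart (x, e).
  exact: smooth_on_differentiable smooth_mul Oxe.
have dmr : differentiable (fun y => mul_chart (x, y)) e.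
  exact: differentiable_comp (dpair_r x e) dm.
have mr : mul_chart (x, e) = x by rewrite /mul_chart /= chinv_self lg_mulr1 chinvK.
have mf' : mdifferentiable (f \o chinv one) (mul_chart (x, e)) by rewrite mr.
have -> : mderive (f \o chinv one) x (left_field_chart Y x) =
  mderive (f \o chinv one) (mul_chart (x, e)) ('D_Y (fun y => mul_chart (x, y)) e).
  by rewrite mr /left_field_chart derive_snd.
rewrite -(mderive_comp _ dmr mf'); apply: near_eq_mderive.
have : \forall y \near e, O (x, y).
  have [/= _ ie dx] := Oxe.
  exact: (differentiable_continuous (dpair_r x e)
    (near_chart_dom2 (lg_mul_smooth G) ix ie dx)).
by apply: filterS => y [/= _ _ dy]; rewrite /mul_chart /= chartK.
Qed.

Lemma left_field_one (v : 'rV[R]_N) : left_field (G := G) v one = v.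
Proof.
rewrite /left_field (_ : (fun k : G => lg_mul one k) = id); last first.
  by apply/funext => k; rewrite lg_mul1.
by rewrite tangent_mapE mderive_chinv_self.
Qed.

Lemma left_field_in_chart v x : img one x ->
  field_in_chart (left_field (G := G) v) one x = left_field_chart v x.
Proof.
move=> ix; have Oxe := O_left ix.
rewrite /field_in_chart /left_field tangent_mapE.
set f := (_ \o _).
have mf : mdifferentiable f e.
  apply: smooth_map2_mdifferentiable (lg_mul_smooth G) _ _.
    exact: mdifferentiable_cst.
  exact: mdifferentiable_chinv (img_self _).
have fe : f e = chinv one x by rewrite /f /= chinv_self lg_mulr1.
have df : dom one (f e) by rewrite fe; exact: dom_chinv.
rewrite -{1}fe -derive_chart // /left_field_chart derive_snd //.
exact: smooth_on_differentiable smooth_mul Oxe.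
Qed.

(** The bracket is defined with left-invariant fields only. By symmetry of the
second derivatives of the multiplication, the derivative in direction [Y] of the
left-invariant field of [Z] is the derivative in direction [Z] of the
right-invariant field of [Y]. *)
Lemma lie_bracketE (Y Z : 'rV[R]_N) :
  lie_bracket G Y Z = 'D_Z (right_field_chart Y) e - 'D_Z (left_field_chart Y) e.
Proof.
rewrite /lie_bracket /field_bracket -/one -/e !left_field_one.
have E v : \forall x \near e,
    field_in_chart (left_field (G := G) v) one x = left_field_chart v x.
  by apply: filterS (near_img (img_self one)) => x; exact: left_field_in_chart.
apply: etrans (congr2 (fun a b => a - b) (near_eq_derive _ (E Z))
  (near_eq_derive _ (E Y))) _.
apply: (congr1 (fun a => a - 'D_Z (left_field_chart Y) e)).
have dD v w : O w -> differentiable ('D_v mul_chart) w.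
  by apply: smooth_on_differentiable; exact: smooth_on_derive.
have nd : \forall w \near (e, e), differentiable mul_chart w.
  by apply: filterS nearO => w; exact: smooth_on_differentiable.
apply: etrans (esym (derive_fst _ (dD _ _ Oee))) _.
apply: etrans (derive_sym nd (dD _ _ Oee) (dD _ _ Oee)) _.
exact: derive_snd (dD _ _ Oee).
Qed.

Lemma right_field_chart_one Y : right_field_chart Y e = Y.
Proof.
rewrite /right_field_chart derive_fst; last first.
  exact: smooth_on_differentiable smooth_mul Oee.
have E : \forall y \near e, mul_chart (y, e) = y.
  apply: filterS (near_img (img_self one)) => y iy.
  by rewrite /mul_chart /= chinv_self lg_mulr1 chinvK.
by rewrite (near_eq_derive _ E) derive_id.
Qed.

Lemma left_field_chart_one Y : left_field_chart Y e = Y.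
Proof.
rewrite /left_field_chart derive_snd; last first.
  exact: smooth_on_differentiable smooth_mul Oee.
have E : \forall y \near e, mul_chart (e, y) = y.
  apply: filterS (near_img (img_self one)) => y iy.
  by rewrite /mul_chart /= chinv_self lg_mul1 chinvK.
by rewrite (near_eq_derive _ E) derive_id.
Qed.

End LieBracket.

(** * Orbits of one-parameter groups in a coset manifold *)

Section CosetGeometry.
Variables (R : realType) (N n : nat) (G : lie_group R N) (H : set G).
Variables (M : manifold R n) (pi : G -> M) (act : G -> M -> M).
Hypothesis HM : coset_manifold H pi act.

Let one := lg_one G.
Let e := chart one one.
Let o := pi one.

Lemma act_one x : act one x = x.
Proof. by have [k <-] := coset_surj HM x; rewrite (coset_act HM) lg_mul1. Qed.

Lemma act_mul g k x : act (lg_mul g k) x = act g (act k x).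
Proof. by have [j <-] := coset_surj HM x; rewrite !(coset_act HM) lg_mulA. Qed.

Lemma act_mdifferentiable (V : normedModType R) (f : V -> G) (x : V -> M) a :
  mdifferentiable f a -> mdifferentiable x a ->
  mdifferentiable (fun z => act (f z) (x z)) a.
Proof. exact: smooth_map2_mdifferentiable (coset_act_smooth HM). Qed.

Lemma tangent_act (V : normedModType R) (x : V -> M) a v g q :
  mdifferentiable x a -> x a = q ->
  tangent_map (act g) q (mderive x a v) = mderive (fun z => act g (x z)) a v.
Proof.
move=> mx <-; apply: tangent_map_mderive => //.
apply: act_mdifferentiable; first exact: mdifferentiable_cst.
exact: mdifferentiable_chinv (img_self _).
Qed.

Lemma pi_mdifferentiable (V : normedModType R) (f : V -> G) a :
  mdifferentiable f a -> mdifferentiable (fun z => pi (f z)) a.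
Proof. exact: smooth_map_mdifferentiable (coset_smooth HM). Qed.

Lemma tangent_pi (V : normedModType R) (f : V -> G) a v g :
  mdifferentiable f a -> f a = g ->
  tangent_map pi g (mderive f a v) = mderive (fun z => pi (f z)) a v.
Proof.
move=> mf <-; apply: tangent_map_mderive => //.
apply: pi_mdifferentiable; exact: mdifferentiable_chinv (img_self _).
Qed.

Lemma mderive0_ext (f g : R -> M) : f =1 g -> mderive f (0 : R) 1 = mderive g 0 1.
Proof. by move=> /funext ->. Qed.

Lemma tangent_act0 g x : tangent_map (act g) x 0 = 0.
Proof. by rewrite /tangent_map derive0. Qed.

Lemma pi_chinv_mdifferentiable x : img one x -> mdifferentiable (pi \o chinv one) x.
Proof. by move=> ix; apply: pi_mdifferentiable; exact: mdifferentiable_chinv. Qed.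

Lemma tangent_at_oE Z : tangent_at_o pi Z = mderive (pi \o chinv one) e Z.
Proof. exact: tangent_mapE. Qed.

Lemma tangent_at_o_linear k u v :
  tangent_at_o pi (k *: u + v) = k *: tangent_at_o pi u + tangent_at_o pi v.
Proof.
rewrite !tangent_at_oE; apply: mderive_linear.
exact: pi_chinv_mdifferentiable (img_self _).
Qed.

Section Orbit.
Variables (c : R -> G) (Y : 'rV[R]_N).
Hypothesis cY : is_exp c Y.

(** When [c] is the one-parameter group of [Y], this is the vector field on G/H
whose flow is the action of [c]. *)
Definition fundamental_field (x : M) : 'rV[R]_n := mderive (fun s => act (c s) x) 0 1.
Local Notation xi := fundamental_field.

Definition orbit_curve (t : R) : M := act (c t) o.
Local Notation gamma := orbit_curve.

Lemma act_exp_mdifferentiable x t : mdifferentiable (fun s => act (c s) x) t.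
Proof.
apply: act_mdifferentiable; first exact: (is_exp_mdifferentiable cY).
exact: mdifferentiable_cst.
Qed.

Lemma act_exp0 x : act (c 0) x = x.
Proof. by rewrite (is_exp0 cY) act_one. Qed.

Lemma act_expD s t x : act (c (s + t)) x = act (c s) (act (c t) x).
Proof. by rewrite (is_expD cY) act_mul. Qed.

Lemma act_expN t x : act (c t) (act (c (- t)) x) = x.
Proof. by rewrite -act_expD addrN act_exp0. Qed.

Lemma orbit_curveD s t : act (c s) (gamma t) = gamma (s + t).
Proof. by rewrite /gamma act_expD. Qed.

Lemma fundamental_field_act t x :
  tangent_map (act (c t)) x (xi x) = xi (act (c t) x).
Proof.
apply: etrans (tangent_act (1 : R) (c t) (act_exp_mdifferentiable x 0) (act_exp0 x)) _.
apply: mderive0_ext => s.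
by rewrite -act_expD addrC act_expD.
Qed.

(** The path [c] is replaced by the chart at the identity, which makes the field
a partial derivative of the action in coordinates. *)
Lemma fundamental_field_chart x :
  xi x = mderive (fun y => act (chinv one y) x) e Y.
Proof.
have c0 := is_exp0 cY; have dc : dom one (c 0) by rewrite c0; exact: dom_self.
pose k s := chart one (c s); pose f y := act (chinv one y) x.
have dk : differentiable k 0.
  exact: mdifferentiable_chart (is_exp_mdifferentiable cY 0) dc.
have k0 : k 0 = e by rewrite /k c0.
have mf : mdifferentiable f (k 0).
  rewrite k0; apply: act_mdifferentiable; last exact: mdifferentiable_cst.
  exact: mdifferentiable_chinv (img_self _).
have -> : xi x = mderive (f \o k) 0 1.
  apply: near_eq_mderive.
  apply: filterS (near_dom (is_exp_mdifferentiable cY 0).1 dc) => s ds.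
  by rewrite /f /k /= chartK.
apply: etrans (mderive_comp (1 : R) dk mf) _.
by rewrite k0 (derive_exp_chart cY).
Qed.

Lemma fundamental_field_o : xi o = tangent_at_o pi Y.
Proof.
rewrite /tangent_at_o -(is_exp_mderive cY).
apply/esym.
apply: etrans (tangent_pi (1 : R) (is_exp_mdifferentiable cY 0) (is_exp0 cY)) _.
apply: mderive0_ext => s.
by rewrite (coset_act HM) lg_mulr1.
Qed.

Lemma orbit_mdifferentiable t : mdifferentiable gamma t.
Proof. exact: act_exp_mdifferentiable. Qed.

Lemma orbit_mderive t : mderive gamma t 1 = xi (gamma t).
Proof.
have dsh : differentiable (fun s : R => s + t) 0 by [].
have -> : xi (gamma t) = mderive (gamma \o (fun s => s + t)) 0 1.
  apply: mderive0_ext => s.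
  by rewrite orbit_curveD.
have mg : mdifferentiable gamma (0 + t) by exact: orbit_mdifferentiable.
apply/esym; apply: etrans (mderive_comp _ dsh mg) _.
have -> : 'D_1 (fun s : R => s + t) 0 = 1.
  rewrite -[LHS]/('D_1 (id + cst t) 0) deriveD //.
  by rewrite derive_id derive_cst addr0.
by rewrite add0r.
Qed.

Hypothesis HH : closed_subgroup H.

(** [c t] is a power of [c (t / k)], which lies in [H] once [t / k < d]. *)
Lemma exp_in_subgroup (d : R) : 0 < d ->
  (forall s, 0 <= s < d -> H (c s)) -> forall t, H (c t).
Proof.
case: HH => _ H1 HM' HV d0 Hd.
have Hpos t : 0 <= t -> H (c t).
  move=> t0; pose k := (Num.truncn (t / d)).+1.
  have k0 : 0 < k%:R :> R by rewrite ltr0n.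
  have s0 : 0 <= t / k%:R < d.
    rewrite divr_ge0 //= ltr_pdivrMr // mulrC -ltr_pdivrMr //.
    exact: truncnS_gt.
  have : forall j : nat, H (c (t / k%:R *+ j)).
    elim=> [|j IH]; first by rewrite mulr0n (is_exp0 cY).
    by rewrite mulrS (is_expD cY); apply: HM' => //; exact: Hd.
  by move=> /(_ k); rewrite -mulr_natr divfK // gt_eqF.
move=> t; have [t0|/ltW t0] := leP 0 t; first exact: Hpos.
have E : lg_mul (c (- t)) (c t) = one by rewrite -(is_expD cY) addNr (is_exp0 cY).
have -> : c t = lg_inv (c (- t)).
  by rewrite -[LHS]lg_mul1 -(lg_mulV (c (- t))) -lg_mulA E lg_mulr1.
by apply: HV; apply: Hpos; rewrite oppr_ge0.
Qed.

(** The velocity of the orbit of [o] is everywhere the image of its velocity at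
time 0 under the action, hence vanishes; the orbit is then constant near time 0,
which puts [c t] in the isotropy group for small [t]. *)
Lemma exp_in_isotropy : tangent_at_o pi Y = 0 -> forall t, H (c t).
Proof.
move=> Y0.
have xi0 t : xi (gamma t) = 0.
  by rewrite /gamma -fundamental_field_act fundamental_field_o Y0 tangent_act0.
have g0 : gamma 0 = o by exact: act_exp0.
have : \forall s \near (0 : R), dom o (gamma s).
  by apply: near_dom (orbit_mdifferentiable 0).1 _; rewrite g0; exact: dom_self.
move=> /nbhs_ballP[d /= d0 Bd].
have Bd' s : 0 <= s < d -> dom o (gamma s).
  move=> /andP[s0 sd]; apply: Bd.
  by rewrite -ball_normE /= sub0r normrN ger0_norm.
apply: (exp_in_subgroup d0) => t /andP[t0 td].
have du s : 0 <= s <= t -> is_derive s 1 (fun r => chart o (gamma r)) 0.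
  move=> /andP[s0 st].
  have ds : dom o (gamma s) by apply: Bd'; rewrite s0 (le_lt_trans st td).
  have df := mdifferentiable_chart (orbit_mdifferentiable s) ds.
  split; first exact: diff_derivable.
  rewrite (derive_chart _ (orbit_mdifferentiable s)) // orbit_mderive xi0.
  by rewrite /to_chart derive0.
have E : chart o (gamma t) = chart o (gamma 0).
  apply/rowP => i.
  have dui s : 0 <= s <= t -> is_derive s 1 (fun r => chart o (gamma r) 0 i : R) 0.
    move=> st; have [dv ds] := du s st.
    have df : differentiable (fun r => chart o (gamma r)) s by exact/derivable1_diffP.
    split; first exact: (diff_derivable (differentiable_entry i df)).
    by rewrite -derive_row // ds mxE.
  have M1 x : x \in `]0, t[ ->
      is_derive x 1 (fun r => chart o (gamma r) 0 i : R) ((cst 0 : R -> R) x).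
    by rewrite in_itv /= => /andP[x0 xt]; apply: dui; rewrite !ltW.
  have M2 : {within `[0, t], continuous (fun r => chart o (gamma r) 0 i : R)}.
    apply: derivable_within_continuous => x; rewrite in_itv /= => xt.
    by have [] := dui x xt.
  have [x _] := MVT_segment t0 M1 M2.
  by rewrite /cst mul0r => /eqP; rewrite subr_eq0 => /eqP.
have gt : gamma t = gamma 0.
  rewrite -[LHS](chartK (p := o)); last by apply: Bd'; rewrite t0 td.
  by rewrite E chartK // g0; exact: dom_self.
have : pi one = pi (c t).
  by rewrite -/o -g0 -gt /gamma (coset_act HM) lg_mulr1.
by move=> /(coset_fibre HM); rewrite lg_inv1 lg_mul1.
Qed.

End Orbit.

Lemma tangent_at_o_isotropy Z : closed_subgroup H -> in_lie_algebra H Z ->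
  tangent_at_o pi Z = 0.
Proof.
move=> HH [c cZ Hc]; rewrite -(fundamental_field_o cZ) /fundamental_field.
have E : (fun s => act (c s) o) = cst o.
  apply/funext => s; rewrite (coset_act HM) lg_mulr1; apply/esym.
  by apply/(coset_fibre HM); rewrite lg_inv1 lg_mul1; exact: Hc.
rewrite E -[LHS]/('D_1 (cst (chart o o) : R -> _) 0).
exact: derive_cst.
Qed.

End CosetGeometry.

(** * Pairing of an invariant field with a fundamental field *)

Section InvariantField.
Variables (R : realType) (N n : nat) (G : lie_group R N) (H : set G).
Variables (M : manifold R n) (pi : G -> M) (act : G -> M -> M).
Hypothesis HM : coset_manifold H pi act.
Variables (a : M -> 'rV[R]_n -> 'rV[R]_n -> R) (X : M -> 'rV[R]_n).
Hypotheses (ra : riemannian_metric a) (inva : invariant_form act a).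
Hypotheses (sX : smooth_field X) (invX : invariant_field act X).
Variables (c : R -> G) (Y : 'rV[R]_N).
Hypothesis cY : is_exp c Y.

Let one := lg_one G.
Let e := chart one one.
Let o := pi one.
Local Notation xi := (fundamental_field act c).

Definition beta_orbit (x : M) : R := a x (X x) (xi x).

Lemma beta_orbit_act t x : beta_orbit (act (c t) x) = beta_orbit x.
Proof. by rewrite /beta_orbit -(fundamental_field_act HM cY) -invX inva. Qed.

Let pi_chart (x : 'rV[R]_N) := chart o (pi (chinv one x)).
Let D := [set x | img one x /\ dom o (pi (chinv one x))].

Let smooth_pi : smooth_on D pi_chart.
Proof. by have [_ sp] := coset_smooth HM; exact: sp. Qed.

Let nearD : \forall x \near e, D x.
Proof.
have mp := pi_chinv_mdifferentiable HM (img_self one).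
have doe : dom o ((pi \o chinv one) e) by rewrite /= chinv_self; exact: dom_self.
by apply: filterS2 (near_img (img_self one)) (near_dom mp.1 doe) => x ix dx.
Qed.

Let De : D e. Proof. exact: nbhs_singleton nearD. Qed.

Let theta (z : 'rV[R]_N * 'rV[R]_N) : R :=
  beta_chart a X o (pi_chart z.1, 'D_(z.2) pi_chart z.1).

Let thetaE x y : D x ->
  theta (x, y) = a (pi (chinv one x)) (X (pi (chinv one x)))
                   (mderive (pi \o chinv one) x y).
Proof.
move=> [ix dx]; rewrite /theta /beta_chart /pi_chart /= chartK //; congr (a _ _ _).
by apply/esym; exact: (mderive_from_chart y (pi_chinv_mdifferentiable HM ix) dx).
Qed.

Let dtheta y : differentiable theta (e, y).
Proof.
have dp x : D x -> differentiable pi_chart x.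
  exact: smooth_on_differentiable smooth_pi.
apply: (@differentiable_comp _ _ _ _
  (fun z : 'rV[R]_N * 'rV[R]_N => (pi_chart z.1, 'D_(z.2) pi_chart z.1))
  (beta_chart a X o)).
  apply: differentiable_pair.
    apply: (@differentiable_comp _ _ _ _ fst pi_chart (e, y)); last exact: dp.
    exact: differentiable_fst.
  apply: differentiable_derive_joint.
    by apply: filterS nearD => x; exact: dp.
  by move=> v; apply: smooth_on_differentiable De; exact: smooth_on_derive.
apply: (differentiable_beta ra sX); apply: img_chart.
by rewrite chinv_self; exact: dom_self.
Qed.

Let theta_left x : D x ->
  theta (x, left_field_chart G Y x) = a o (X o) (tangent_at_o pi Y).
Proof.
move=> Dx; have [ix _] := Dx.
have mpe := pi_chinv_mdifferentiable HM (img_self one).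
rewrite thetaE // (left_field_mderive Y ix (pi_chinv_mdifferentiable HM ix)).
have pe : (pi \o chinv one) e = o by rewrite /= chinv_self.
have -> : mderive (fun y => pi (lg_mul (chinv one x) (chinv one y))) e Y =
    tangent_map (act (chinv one x)) o (tangent_at_o pi Y).
  rewrite (tangent_at_oE pi) (tangent_act HM _ _ mpe pe).
  apply: (congr1 (fun f => mderive f e Y)); apply/funext => y.
  by rewrite (coset_act HM).
have -> : pi (chinv one x) = act (chinv one x) o by rewrite (coset_act HM) lg_mulr1.
by rewrite -invX inva.
Qed.

Let theta_right x : D x ->
  theta (x, right_field_chart G Y x) = beta_orbit (pi (chinv one x)).
Proof.
move=> Dx; have [ix _] := Dx.
rewrite thetaE // (right_field_mderive Y ix (pi_chinv_mdifferentiable HM ix)).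
rewrite /beta_orbit; congr (a _ _ _).
rewrite (fundamental_field_chart HM cY).
apply: (congr1 (fun f => mderive f e Y)); apply/funext => y.
by rewrite (coset_act HM).
Qed.

(** The pullback of [a (X, .)] to G is a left-invariant 1-form, [theta] in
coordinates. It is constant on the left-invariant field of [Y], and its value on
the right-invariant field of [Y] at [g] is the pairing of [X] with [xi] at [gH].
The two fields agree at the identity, so that in the difference of the derivatives
in direction [Z] the derivative of [theta] itself cancels; what remains is [theta]
at the identity, applied to the bracket. *)
Lemma derive_beta_orbit Z :
  'D_Z (fun x => beta_orbit (pi (chinv one x))) e =
  a o (X o) (tangent_at_o pi (lie_bracket G Y Z)).
Proof.
have dpath (f : 'rV[R]_N -> 'rV[R]_N) : differentiable f e ->
    differentiable (fun x : 'rV[R]_N => (x, f x)) e.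
  by move=> df; apply: differentiable_pair.
have derpath (f : 'rV[R]_N -> 'rV[R]_N) : differentiable f e -> f e = Y ->
    'D_Z (fun x => theta (x, f x)) e = 'D_(Z, 'D_Z f e) theta (e, Y).
  move=> df fe; have dt : differentiable theta (e, f e) by exact: dtheta.
  apply: etrans (derive_comp (f := theta) Z (dpath _ df) dt) _.
  rewrite fe; apply: (congr1 (fun w => 'D_w theta (e, Y))).
  apply: etrans (derive_pair Z (ex_diff (is_diff_def := is_diff_id e)) df) _.
  by rewrite derive_id.
have dl := @differentiable_left_field R N G Y.
have dr := @differentiable_right_field R N G Y.
have El : 'D_(Z, 'D_Z (left_field_chart G Y) e) theta (e, Y) = 0.
  rewrite -(derpath _ dl (left_field_chart_one G Y)).
  have E : \forall x \near e, theta (x, left_field_chart G Y x) =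
      cst (a o (X o) (tangent_at_o pi Y)) x.
    by apply: filterS nearD => x; exact: theta_left.
  by rewrite (near_eq_derive _ E) derive_cst.
have Er : 'D_Z (fun x => beta_orbit (pi (chinv one x))) e =
    'D_(Z, 'D_Z (right_field_chart G Y) e) theta (e, Y).
  rewrite -(derpath _ dr (right_field_chart_one G Y)); apply: near_eq_derive.
  by apply: filterS nearD => x Dx; rewrite theta_right.
set w := lie_bracket G Y Z.
(* The derivatives of [theta] along the two fields differ by a vertical vector. *)
have wE : (Z, 'D_Z (right_field_chart G Y) e) =
    (0, w) + (Z, 'D_Z (left_field_chart G Y) e).
  by rewrite /w lie_bracketE [RHS]surjective_pairing /= add0r subrK.
rewrite Er wE derive_dirD; last exact: dtheta.
rewrite El addr0.
have dt : differentiable theta (e, Y) by exact: dtheta.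
apply: etrans (derive_snd _ dt) _.
have tE y : theta (e, y) = a o (X o) (mderive (pi \o chinv one) e y).
  by apply: etrans (thetaE y De) _; rewrite chinv_self.
have tlin k u v : theta (e, k *: u + v) = k * theta (e, u) + theta (e, v).
  apply: etrans (tE _) _.
  rewrite (mderive_linear k u v (pi_chinv_mdifferentiable HM (img_self one))).
  by rewrite (metric_linear_r ra) (tE u) (tE v).
apply: etrans (derive_functional Y w tlin) _.
by rewrite tE (tangent_at_oE pi).
Qed.

End InvariantField.

(** * Euler-Lagrange equations of an invariant metric along an orbit *)

Section OrbitEulerLagrange.
Variables (R : realType) (N n : nat) (G : lie_group R N) (H : set G).
Variables (M : manifold R n) (pi : G -> M) (act : G -> M -> M).
Hypothesis HM : coset_manifold H pi act.
Variables (c : R -> G) (Y : 'rV[R]_N).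
Hypothesis cY : is_exp c Y.

Let one := lg_one G.
Let e := chart one one.
Local Notation xi := (fundamental_field act c).
Local Notation gamma := (orbit_curve pi act c).

Variables (p : M) (t : R).
Hypothesis dpt : dom p (gamma t).

Let u s := chart p (gamma s).
Let k s := chart one (c s).
Let m (w : 'rV[R]_N * 'rV[R]_n) := chart p (act (chinv one w.1) (chinv p w.2)).
Let O := [set w : 'rV[R]_N * 'rV[R]_n | [/\ img one w.1, img p w.2 &
                     dom p (act (chinv one w.1) (chinv p w.2))]].

Let smooth_m : smooth_on O m.
Proof. by have [_ sm] := coset_act_smooth HM; exact: sm. Qed.

Let O_e x : img p x -> O (e, x).
Proof.
move=> ix; split => //=; first exact: img_self.
by rewrite chinv_self (act_one HM); exact: dom_chinv.
Qed.

Let iu : img p (u t). Proof. exact: img_chart. Qed.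

Let O_near : \forall z \near (e, u t), O z.
Proof.
by have [/= ie ix dx] := O_e iu; exact: near_chart_dom2 (coset_act_smooth HM) ie ix dx.
Qed.

Lemma fundamental_field_in_chart x : img p x ->
  'D_(Y, 0) m (e, x) = field_in_chart xi p x.
Proof.
move=> ix; have Ox := O_e ix.
rewrite derive_fst; last exact: smooth_on_differentiable smooth_m Ox.
pose f y := act (chinv one y) (chinv p x).
have mf : mdifferentiable f e.
  apply: (act_mdifferentiable HM); last exact: mdifferentiable_cst.
  exact: mdifferentiable_chinv (img_self _).
have fe : f e = chinv p x by rewrite /f chinv_self (act_one HM).
have df : dom p (f e) by rewrite fe; exact: dom_chinv.
apply: etrans (derive_chart Y mf df) _.
by rewrite fe -(fundamental_field_chart HM cY).
Qed.

Let near_gamma : \forall s \near t, dom p (gamma s).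
Proof. exact: near_dom (orbit_mdifferentiable HM cY t).1 dpt. Qed.

Let near_c : \forall s \near t, dom one (c (t - s)).
Proof.
have mc : mdifferentiable c (t - t) by exact: is_exp_mdifferentiable cY _.
have dsub : differentiable (fun s : R => t - s) t by exact: differentiableB.
apply: (near_dom (mdifferentiable_comp dsub mc).1).
by rewrite /= subrr (is_exp0 cY); exact: dom_self.
Qed.

Let k0 : k 0 = e. Proof. by rewrite /k (is_exp0 cY). Qed.

Let dk : differentiable k 0.
Proof.
apply: mdifferentiable_chart (is_exp_mdifferentiable cY 0) _.
by rewrite (is_exp0 cY); exact: dom_self.
Qed.

Let du : \forall s \near t, differentiable u s.
Proof.
by apply: filterS near_gamma => s ds;
   exact: mdifferentiable_chart (orbit_mdifferentiable HM cY s) ds.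
Qed.

Let u't : derive1 u t = 'D_(Y, 0) m (e, u t).
Proof.
rewrite derive1E fundamental_field_in_chart //.
apply: etrans (derive_chart (1 : R) (orbit_mdifferentiable HM cY t) dpt) _.
by rewrite (orbit_mderive HM cY) /field_in_chart chartK.
Qed.

Let flow_u :
  \forall s \near t, \forall r \near s, m (k (t - s), u r) = u (r + (t - s)).
Proof.
apply: filterS2 near_c (nbhs_interior near_gamma) => s dc.
apply: filterS => r dr.
by rewrite /m /k /u /= !chartK // (orbit_curveD HM cY) addrC.
Qed.

Let m_id : \forall x \near u t, m (e, x) = x.
Proof.
apply: filterS (near_img iu) => x ix.
by rewrite /m /= chinv_self (act_one HM) chinvK.
Qed.

Variable F : M -> 'rV[R]_n -> R.
Hypothesis invF : invariant_fun act F.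
Let L x y := 2^-1 * fun_in_chart F p x y ^+ 2.

Let L_inv :
  \forall s \near t, forall y, L (u s) y = L (u t) ('D_(0, y) m (k (t - s), u s)).
Proof.
have nO : \forall s \near t, O (k (t - s), u s).
  apply: filterS2 near_c near_gamma => s dc dg; split => /=.
  - exact: img_chart.
  - exact: img_chart.
  - by rewrite /k /u !chartK // (orbit_curveD HM cY) subrK.
apply: filterS3 near_c near_gamma nO => s dc dg Os y.
rewrite /L; congr (_ * _ ^+ 2).
rewrite derive_snd; last exact: smooth_on_differentiable smooth_m Os.
have iu' : img p (u s) by exact: img_chart.
have mch := mdifferentiable_chinv iu'.
have gE : chinv p (u s) = gamma s by rewrite /u chartK.
have cE : chinv one (k (t - s)) = c (t - s) by rewrite /k chartK.
pose f z := act (c (t - s)) (chinv p z).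
have mf : mdifferentiable f (u s).
  by apply: (act_mdifferentiable HM) mch; exact: mdifferentiable_cst.
have fE : f (u s) = gamma t by rewrite /f gE (orbit_curveD HM cY) subrK.
have uE : chinv p (u t) = gamma t by rewrite /u chartK.
rewrite /fun_in_chart uE gE -(invF (c (t - s))) (orbit_curveD HM cY) subrK.
apply: (congr1 (F (gamma t))).
apply: etrans (tangent_act HM y (c (t - s)) mch gE) _.
have df : dom p (f (u s)) by rewrite fE.
apply: etrans (mderive_from_chart y mf df) _.
have -> : chart p (f (u s)) = u t by rewrite fE.
apply: (congr1 (from_chart p (u t))); apply: (congr1 (fun h => 'D_y h (u s))).
by apply/funext => z; rewrite /m /f /= cE.
Qed.

(** In the chart at [p] the action of [c] is a symmetry of the Lagrangian, so the
general statement for orbits of a symmetry applies. *)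
Lemma orbit_euler_lagrange v :
  differentiable (fun z : 'rV[R]_n * 'rV[R]_n => L z.1 z.2)
    (u t, field_in_chart xi p (u t)) ->
  is_derive t 1 (fun s => 'D_v (L (u s)) (derive1 u s))
    ('D_v (fun x => L x (derive1 u t)) (u t)) <->
  'D_v (fun x => L x (field_in_chart xi p x)) (u t) = 0.
Proof.
move=> dL.
have dL' : differentiable (fun z : 'rV[R]_n * 'rV[R]_n => L z.1 z.2)
    (u t, 'D_(Y, 0) m (e, u t)) by rewrite fundamental_field_in_chart.
have EL := euler_lagrange_orbit O_near smooth_m k0 dk (derive_exp_chart cY) du
  u't flow_u m_id L_inv dL' v.
have E : \forall x \near u t,
    L x ('D_(Y, 0) m (e, x)) = L x (field_in_chart xi p x).
  by apply: filterS (near_img iu) => x ix; rewrite fundamental_field_in_chart.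
have D := near_eq_derive v E.
by apply: iff_trans EL _; split=> h; [exact: etrans (esym D) h|exact: etrans D h].
Qed.

Lemma fundamental_field_differentiable : differentiable (field_in_chart xi p) (u t).
Proof.
apply: (@near_eq_differentiable _ _ _ (fun x => 'D_(Y, 0) m (e, x))).
  by apply: filterS (near_img iu) => x; exact: fundamental_field_in_chart.
apply: (@differentiable_comp _ _ _ _ (fun x => (e, x)) ('D_(Y, 0) m)).
  exact: (differentiable_pair (differentiable_cst _ _) _).
apply: smooth_on_differentiable (O_e iu); exact: smooth_on_derive.
Qed.

End OrbitEulerLagrange.

(** * Comparison of the two geodesic equations *)

Section ReductiveSplitting.
Variables (R : realType) (N n : nat) (G : lie_group R N) (H : set G).
Variables (M : manifold R n) (pi : G -> M) (act : G -> M -> M).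
Variables (m h : {vspace 'rV[R]_N}).
Hypothesis HH : closed_subgroup H.
Hypothesis HM : coset_manifold H pi act.
Hypothesis mh : reductive_decomposition H m h.

Lemma projection_split Z : daddv_pi m h Z + daddv_pi h m Z = Z.
Proof. by case: mh => _ mh1 mh0 _; rewrite daddv_pi_add // mh1 memvf. Qed.

Lemma tangent_at_o_proj Z : tangent_at_o pi (daddv_pi m h Z) = tangent_at_o pi Z.
Proof.
rewrite -{2}(projection_split Z) -[X in tangent_at_o pi (X + _)]scale1r.
rewrite (tangent_at_o_linear HM) scale1r.
have [mh1 _ _ _] := mh.
have -> : tangent_at_o pi (daddv_pi h m Z) = 0.
  by apply: (tangent_at_o_isotropy HM HH); apply/mh1; exact: memv_pi.
by rewrite addr0.
Qed.

(** A vector [Y] with zero image in the tangent space of G/H at [o] generates a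
subgroup of [H], so its component in [m] vanishes. *)
Lemma tangent_at_o_neq0 (c : R -> G) Y : is_exp c Y -> daddv_pi m h Y != 0 ->
  tangent_at_o pi Y != 0.
Proof.
move=> cY; apply: contra_neq => Y0; have [mh1 _ mh0 _] := mh.
have Yh : Y \in h.
  by apply/mh1; exists c => // t; exact: (exp_in_isotropy HM cY HH Y0 t).
have := projection_split Y.
have hm0 : (h :&: m = 0)%VS by rewrite capvC.
by rewrite (daddv_pi_id hm0 Yh) => /(canRL (addrK _)); rewrite subrr.
Qed.

End ReductiveSplitting.

Section GeodesicOrbits.
Variables (R : realType) (N n : nat) (G : lie_group R N) (H : set G).
Variables (M : manifold R n) (pi : G -> M) (act : G -> M -> M).
Hypothesis HM : coset_manifold H pi act.
Variables (a : M -> 'rV[R]_n -> 'rV[R]_n -> R) (X : M -> 'rV[R]_n).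
Hypotheses (ra : riemannian_metric a) (inva : invariant_form act a).
Hypotheses (sX : smooth_field X) (invX : invariant_field act X).
Variables (c : R -> G) (Y : 'rV[R]_N).
Hypothesis cY : is_exp c Y.

Let one := lg_one G.
Let e := chart one one.
Let o := pi one.
Local Notation xi := (fundamental_field act c).
Local Notation gamma := (orbit_curve pi act c).

Lemma alpha2_orbit t : a (gamma t) (xi (gamma t)) (xi (gamma t)) =
  a o (tangent_at_o pi Y) (tangent_at_o pi Y).
Proof. by rewrite -(fundamental_field_act HM cY) inva (fundamental_field_o HM cY). Qed.

Lemma invariant_rnorm : invariant_fun act (rnorm a).
Proof. by move=> g x y; rewrite /rnorm inva. Qed.

Section AtPoint.
Variables (p : M) (t : R).
Hypothesis dpt : dom p (gamma t).
Let u := chart p (gamma t).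
Let iu : img p u. Proof. exact: img_chart. Qed.
Let uE : chinv p u = gamma t. Proof. by rewrite chartK. Qed.

Let A x := alpha2_chart a p (x, field_in_chart xi p x).
Let B x := beta_chart a X p (x, field_in_chart xi p x).

Let dpath : differentiable (fun x => (x, field_in_chart xi p x)) u.
Proof. 
have d : differentiable (field_in_chart xi p) u :=
  fundamental_field_differentiable HM cY dpt.
exact: differentiable_pair _ d.
Qed.

Lemma differentiable_alpha2_orbit : differentiable A u.
Proof. exact: differentiable_comp dpath (differentiable_alpha2 ra _). Qed.

Lemma differentiable_beta_orbit : differentiable B u.
Proof. exact: differentiable_comp dpath (differentiable_beta ra sX _). Qed.

Lemma beta_chart_orbit x : img p x -> B x = beta_orbit act a X c (chinv p x).
Proof. by move=> ix; rewrite /B /beta_chart /= field_in_chartK. Qed.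

Lemma alpha2_chart_orbit : A u = a o (tangent_at_o pi Y) (tangent_at_o pi Y).
Proof. by rewrite /A /alpha2_chart /= field_in_chartK // uE alpha2_orbit. Qed.

(** [w] is the image of [v] under the action of [c (- t)], which carries
[gamma t] back to [o]. *)
Lemma tangent_at_orbit_surj v : exists w, forall Z, tangent_at_o pi Z = w ->
  'D_Z (fun x => chart p (act (c t) (pi (chinv one x)))) e = v.
Proof.
pose v' := mderive (chinv p) u v.
have mch := mdifferentiable_chinv iu.
have mN : mdifferentiable (fun x => act (c (- t)) (chinv p x)) u.
  by apply: (act_mdifferentiable HM) mch; exact: mdifferentiable_cst.
have goE : act (c (- t)) (chinv p u) = o.
  by rewrite uE (orbit_curveD HM cY) addNr /orbit_curve (act_exp0 HM cY).
exists (tangent_map (act (c (- t))) (gamma t) v') => Z dZ.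
pose f x := act (c t) (pi (chinv one x)).
have mpi := pi_chinv_mdifferentiable HM (img_self one).
have mf : mdifferentiable f e.
  by apply: (act_mdifferentiable HM) mpi; exact: mdifferentiable_cst.
have fe : f e = gamma t by rewrite /f chinv_self.
have df : dom p (f e) by rewrite fe.
apply: etrans (derive_chart Z mf df) _.
have -> : mderive f e Z = v'.
  have pe : (pi \o chinv one) e = o by rewrite /= chinv_self.
  apply: etrans (esym (tangent_act HM Z (c t) mpi pe)) _.
  rewrite -(tangent_at_oE pi) dZ.
  rewrite /v' (tangent_act HM v _ mch uE) (tangent_act HM v _ mN goE).
  apply: (congr1 (fun f => mderive f u v)); apply/funext => x.
  by rewrite (act_expN HM cY).
by rewrite fe -uE; exact: from_chartK.
Qed.

Hypothesis XY : forall v, exists2 Z,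
  'D_Z (fun x => chart p (act (c t) (pi (chinv one x)))) e = v &
  a o (X o) (tangent_at_o pi (lie_bracket G Y Z)) = 0.

(** Every direction at [gamma t] is the image under [c t] of a direction at [o],
and the pairing of [X] with [xi] is invariant under [c t]; so the derivative is
the one already computed at the identity of G. *)
Lemma derive_beta_chart_orbit v : 'D_v B u = 0.
Proof.
have [Z dZ bZ] := XY v.
pose w x := chart p (act (c t) (pi (chinv one x))).
have we : w e = u by rewrite /w chinv_self.
have mw : mdifferentiable (fun x => act (c t) (pi (chinv one x))) e.
  have mpi := pi_chinv_mdifferentiable HM (img_self one).
  by apply: (act_mdifferentiable HM) mpi; exact: mdifferentiable_cst.
have dw' : dom p (act (c t) (pi (chinv one e))) by rewrite chinv_self.
have dw : differentiable w e := mdifferentiable_chart mw dw'.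
have dB : differentiable B (w e) by rewrite we; exact: differentiable_beta_orbit.
have := derive_comp Z dw dB; rewrite dZ we => <-.
apply: etrans _ bZ.
apply: etrans _ (derive_beta_orbit HM ra inva sX invX cY Z).
apply: near_eq_derive; apply: filterS (near_dom mw.1 dw') => x dx.
rewrite /= beta_chart_orbit; last exact: img_chart.
by rewrite /w chartK // (beta_orbit_act HM inva invX cY).
Qed.

Variables (phi : R -> R) (b0 : R).
Hypothesis ab : ab_function phi b0.
Hypothesis Xb : forall x, Num.sqrt (a x (X x) (X x)) < b0.
Hypothesis invF : invariant_fun act (ab_metric phi a X).
Hypothesis Y0 : tangent_at_o pi Y != 0.

(** Along the orbit the pairing of [X] with [xi] is stationary, so the two energies
have proportional differentials; the factor [phi s * (phi s - s * phi' s)] is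
positive. *)
Lemma euler_lagrange_ab_iff v :
  let EL F := let L (x y : 'rV[R]_n) := 2^-1 * fun_in_chart F p x y ^+ 2 in
    is_derive t 1
      (fun s => 'D_v (L (chart p (gamma s))) (derive1 (fun s => chart p (gamma s)) s))
      ('D_v (fun x => L x (derive1 (fun s => chart p (gamma s)) t))
         (chart p (gamma t))) in
  EL (ab_metric phi a X) <-> EL (rnorm a).
Proof.
have A0 : 0 < A u by rewrite alpha2_chart_orbit; exact: (rm_pos ra).
set s := B u / Num.sqrt (A u).
have sb : `|s| < b0.
  apply: le_lt_trans (Xb (gamma t)).
  have BE : B u = a (gamma t) (X (gamma t)) (xi (gamma t)).
    by rewrite beta_chart_orbit // uE.
  have AE : A u = a (gamma t) (xi (gamma t)) (xi (gamma t)).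
    by rewrite alpha2_chart_orbit alpha2_orbit.
  rewrite /s BE AE; apply: cauchy_schwarz_form.
  - by move=> k x y z; exact: (rm_linear ra).
  - by move=> x y; exact: (rm_sym ra).
  - by move=> x; exact: metric_ge0.
  - by rewrite -AE.
have dphi : differentiable phi s by exact: smooth_on_differentiable (ab_smooth ab) sb.
have factor : phi s * (phi s - s * derive1 phi s) != 0.
  rewrite gt_eqF // mulr_gt0 //; first exact: (ab_pos ab).
  (* For [b = |s|] the coefficient of the second derivative of [phi] vanishes. *)
  have := ab_convex ab (lexx `|s|) sb.
  by rewrite -normrX ger0_norm ?sqr_ge0 // subrr mul0r addr0.
pose z := (u, field_in_chart xi p u).
have dA : differentiable (alpha2_chart a p) z by exact: differentiable_alpha2.
have dB : differentiable (beta_chart a X p) z by exact: differentiable_beta.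
have A0z : 0 < alpha2_chart a p z := A0.
have dLF : differentiable (fun z : 'rV[R]_n * 'rV[R]_n =>
    2^-1 * fun_in_chart (ab_metric phi a X) p z.1 z.2 ^+ 2) z.
  rewrite (_ : (fun _ => _) =
    (fun w => ab_energy phi (alpha2_chart a p w) (beta_chart a X p w))).
    exact: (differentiable_ab_energy A0z dA dB dphi).
  by apply/funext => -[x y].
have dLa : differentiable (fun z : 'rV[R]_n * 'rV[R]_n =>
    2^-1 * fun_in_chart (rnorm a) p z.1 z.2 ^+ 2) z.
  have dq := differentiable_sqrt A0z dA.
  rewrite (_ : (fun _ => _) = 2^-1 *: (fun w => Num.sqrt (alpha2_chart a p w)) ^+ 2).
    by apply: differentiableZ; exact: differentiableX.
  by apply/funext => -[x y].
move=> EL.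
apply: iff_trans (orbit_euler_lagrange HM cY dpt invF v dLF) _.
apply: iff_trans _ (iff_sym (orbit_euler_lagrange HM cY dpt invariant_rnorm v dLa)).
have E := derive_ab_energy A0 differentiable_alpha2_orbit differentiable_beta_orbit
  dphi (derive_beta_chart_orbit v).
split=> [EF|Ea].
  have : phi s * (phi s - s * derive1 phi s) *
    'D_v (fun x => 2^-1 * Num.sqrt (A x) ^+ 2) u = 0 by apply: etrans (esym E) EF.
  by move=> /eqP; rewrite mulf_eq0 (negbTE factor) => /eqP.
apply: etrans E _.
by apply: etrans (congr1 _ Ea) _; rewrite mulr0.
Qed.

End AtPoint.
End GeodesicOrbits.

Theorem theorem2p7 (R : realType) (N n : nat)
    (G : lie_group R N) (H : set G) (M : manifold R n)
    (pi : G -> M) (act : G -> M -> M)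
    (m h : {vspace 'rV[R]_N})
    (a : M -> 'rV[R]_n -> 'rV[R]_n -> R) (X : M -> 'rV[R]_n)
    (phi : R -> R) (b0 : R) (Y : 'rV[R]_N) :
  closed_subgroup H ->
  coset_manifold H pi act ->
  reductive_decomposition H m h ->
  riemannian_metric a -> invariant_form act a ->
  smooth_field X -> invariant_field act X ->
  ab_function phi b0 ->
  (forall x, Num.sqrt (a x (X x) (X x)) < b0) ->
  finsler_metric (ab_metric phi a X) ->
  invariant_fun act (ab_metric phi a X) ->
  let o : M := pi (lg_one G) in
  let proj_m (Z : 'rV[R]_N) : 'rV[R]_N := daddv_pi m h Z in
  let Xo : 'rV[R]_n := X o in
  let Ym : 'rV[R]_n := tangent_at_o pi (proj_m Y) in
  let r_m : R := a o Xo Ym / Num.sqrt (a o Ym Ym) in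
  Y != 0 ->
  proj_m Y != 0 ->
  derive1n 2 phi r_m <= 0 ->
  (forall Z : 'rV[R]_N, Z \in m ->
     a o Xo (tangent_at_o pi (proj_m (lie_bracket G Y Z))) = 0) ->
  (geodesic_vector pi act (ab_metric phi a X) Y <->
   geodesic_vector pi act (rnorm a) Y).
Proof.
move=> HH HM mh ra inva sX invX ab Xb _ invF o proj_m Xo Ym r_m Y0 mY0 _ XY.
suff key c : is_exp c Y ->
    is_geodesic (ab_metric phi a X) (fun t => act (c t) o) <->
    is_geodesic (rnorm a) (fun t => act (c t) o).
  by split=> -[_ [c cY /(key c cY) g]]; split => //; exists c.
move=> cY.
have YN0 : tangent_at_o pi Y != 0 by exact: (tangent_at_o_neq0 HH HM mh cY mY0).
have surj p t : dom p (act (c t) o) -> forall v, exists2 Z,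
    'D_Z (fun x => chart p (act (c t) (pi (chinv (lg_one G) x))))
      (chart (lg_one G) (lg_one G)) = v &
    a o (X o) (tangent_at_o pi (lie_bracket G Y Z)) = 0.
  move=> dpt v; have [w wP] := tangent_at_orbit_surj HM cY dpt v.
  have [Z0 dZ0] := coset_submersion HM (lg_one G) w.
  (* A preimage may be moved into [m], where the bracket hypothesis applies. *)
  exists (proj_m Z0).
    by apply: wP; rewrite -[RHS]dZ0; exact: (tangent_at_o_proj HH HM mh Z0).
  by rewrite -(tangent_at_o_proj HH HM mh); apply: XY; exact: memv_pi.
have EL p t v dpt := euler_lagrange_ab_iff HM ra inva sX invX cY dpt
  (surj p t dpt) ab Xb invF YN0 v.
split=> -[sc g]; split=> [|p t dpt L u v]; [exact: sc| |exact: sc|].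
  exact ((EL p t v dpt).1 (g p t dpt v)).
exact ((EL p t v dpt).2 (g p t dpt v)).
Qed.
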